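(* Let $\boldsymbol\sigma=(\ell_2,\ell_3,r)$ be an isomorphism type, let $n$ be a positive integer, and let $k_2=\frac12(n-\ell_2)$. (1) The number of $\mathrm{PSL}_2(\mathbb Z)$-cyclically reduced subgroups of size $n$ and isomorphism type $\boldsymbol\sigma$ is $n\,s(n,k_2,k_3,\ell_2,\ell_3)$, where $k_3=\frac12(n-3\ell_2-4\ell_3-6r+6)$. (2) The number of non-$\mathrm{PSL}_2(\mathbb Z)$-cyclically reduced subgroups of size $n$ and isomorphism type $\boldsymbol\sigma$, where the base vertex (the root of the Stallings graph) is adjacent to an $a$-edge, is $(\ell_3+1)\,s(n,k_2,k_3',\ell_2,\ell_3+1)$, where $k_3'=\frac12(n-3\ell_2-4\ell_3-6r+2)$. (3) The number of non-$\mathrm{PSL}_2(\mathbb Z)$-cyclically reduced subgroups of size $n$ and isomorphism type $\boldsymbol\sigma$, where the base vertex is adjacent to a $b$-edge, is $(\ell_2+1)\,s(n,k_2,k_3'',\ell_2+1,\ell_3)$, where $k_3''=\frac12(n-3\ell_2-4\ell_3-6r+4)$.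
   Context: $\mathrm{PSL}_2(\mathbb Z)=\langle a,b\mid a^2=b^3=1\rangle$. Each element has a unique geodesic representative (words over $\{a,b,b^{-1}\}$ of length at most 1, or alternating $a$ and letters in $\{b,b^{-1}\}$). The Schreier graph of a subgroup $H$ has vertices the cosets $Hg$, undirected $a$-edges between $Hg$ and $Hga$ and directed $b$-edges from $Hg$ to $Hgb$; the Stallings graph $(\Gamma(H),v_0)$ is its subgraph spanned by the loops at $v_0=H$ labeled by geodesic representatives of elements of $H$, rooted at $v_0$. All subgroups considered are finitely generated; the size of $H$ is the number of vertices of $\Gamma(H)$. By Kurosh's theorem $H$ is a free product of $r_2$ copies of $\mathbb Z_2$, $r_3$ copies of $\mathbb Z_3$ and a free group of rank $r$, for some non-negative integers $r_2,r_3,r$; the triple $(r_2,r_3,r)$ is the isomorphism type of $H$. A $\mathrm{PSL}_2(\mathbb Z)$-cyclically reduced graph is a finite connected graph with undirected $a$-edges and directed $b$-edges such that: every vertex lies on exactly one $a$-edge, which is either an $a$-loop or an isolated $a$-edge (joining two distinct vertices); the $b$-edges form a partial injective map on vertices, every vertex lies on a $b$-edge, and each $b$-edge is a $b$-loop, or an isolated $b$-edge (joining two distinct vertices lying on no other $b$-edge), or one of the edges of a $b$-triangle (a directed 3-cycle on three distinct vertices). $H$ is $\mathrm{PSL}_2(\mathbb Z)$-cyclically reduced if $\Gamma(H)$ is. In general, every vertex of $\Gamma(H)$ other than possibly the root is adjacent to both an $a$-edge and a $b$-edge. $s(n,k_2,k_3,\ell_2,\ell_3)$ is the number of labeled $\mathrm{PSL}_2(\mathbb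 Z)$-cyclically reduced graphs (vertices labeled bijectively by $\{1,\dots,n\}$) with $n$ vertices, $k_2$ isolated $a$-edges, $k_3$ isolated $b$-edges, $\ell_2$ $a$-loops and $\ell_3$ $b$-loops (so it is $0$ when no such graph exists).
   Formalization: Subgroups are counted with a labeling of their Stallings graph's vertices by {1,…,n} (n! each); bare counts fail, e.g. n=2, σ=(0,0,1): 2 subgroups, not 4. The halves k2, k3, k3', k3'' are rounded down, since in (3) k2 and k3'' are otherwise never integers when such subgroups exist. *)

(* Defs.v *)
From HB Require Import structures.
From mathcomp Require Import all_boot all_order all_algebra.
From mathcomp Require Import mathcomp_extra boolp classical_sets functions.
From mathcomp Require Import cardinality.
From Stdlib Require Import Relation_Operators.

Set Implicit Arguments.
Unset Strict Implicit.
Unset Printing Implicit Defensive.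

Local Open Scope quotient_scope.

(** ** Groups given by a presentation <X | R>

    The letter (x, false) stands for x and (x, true) for x^-1. *)

Definition word (X : choiceType) := seq (X * bool).

Section Presentation.
Variables (X : choiceType) (R : set (word X)).

Inductive pres_eq : word X -> word X -> Prop :=
| pres_refl u : pres_eq u u
| pres_sym u v : pres_eq u v -> pres_eq v u
| pres_trans u v w : pres_eq u v -> pres_eq v w -> pres_eq u w
| pres_cat u u' v v' : pres_eq u u' -> pres_eq v v' -> pres_eq (u ++ v) (u' ++ v')
| pres_cancel x e : pres_eq [:: (x, e); (x, ~~ e)] [::]
| pres_rel r : R r -> pres_eq r [::].

Definition pres_eqb (u v : word X) : bool := `[< pres_eq u v >].

Lemma pres_eqb_refl : reflexive pres_eqb.
Proof. by move=> u; apply/asboolP; apply: pres_refl. Qed.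

Lemma pres_eqb_sym : symmetric pres_eqb.
Proof. by move=> u v; apply/asboolP/asboolP => /pres_sym. Qed.

Lemma pres_eqb_trans : transitive pres_eqb.
Proof.
move=> v u w /asboolP uv /asboolP vw; apply/asboolP.
exact: pres_trans uv vw.
Qed.

Canonical pres_equiv := EquivRel pres_eqb pres_eqb_refl pres_eqb_sym pres_eqb_trans.

Definition pres_group : Type := {eq_quot pres_equiv}.

HB.instance Definition _ := Choice.on pres_group.
HB.instance Definition _ := EqQuotient.on pres_group.

Definition of_word (u : word X) : pres_group := \pi_pres_group u.

Definition word_inv (u : word X) : word X := rev [seq (l.1, ~~ l.2) | l <- u].

Definition pres_one : pres_group := of_word [::].
Definition pres_mul (g h : pres_group) : pres_group := of_word (repr g ++ repr h).
Definition pres_inv (g : pres_group) : pres_group := of_word (word_inv (repr g)).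

Lemma of_wordP u v : of_word u = of_word v <-> pres_eq u v.
Proof.
split=> [/eqP|uv]; first by rewrite /of_word eqmodE => /asboolP.
by apply/eqP; rewrite /of_word eqmodE; apply/asboolP.
Qed.

Lemma repr_of_word u : pres_eq (repr (of_word u)) u.
Proof. by apply/of_wordP; rewrite /of_word reprK. Qed.

Lemma word_invK : involutive word_inv.
Proof.
move=> u; rewrite /word_inv map_rev revK -map_comp map_id_in // => -[x e] _ /=.
by rewrite negbK.
Qed.

Lemma pres_mulV u : pres_eq (u ++ word_inv u) [::].
Proof.
elim: u => [|[x e] u IH]; first exact: pres_refl.
have -> : word_inv ((x, e) :: u) = word_inv u ++ [:: (x, ~~ e)].
  by rewrite /word_inv /= rev_cons -cats1.
apply: pres_trans (pres_cancel x e).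
have -> : ((x, e) :: u) ++ word_inv u ++ [:: (x, ~~ e)] =
          [:: (x, e)] ++ (u ++ word_inv u) ++ [:: (x, ~~ e)] by rewrite !catA.
apply: (pres_cat (pres_refl [:: (x, e)])).
exact: (pres_cat IH (pres_refl [:: (x, ~~ e)])).
Qed.

Lemma pres_Vmul u : pres_eq (word_inv u ++ u) [::].
Proof. by rewrite -{2}[u]word_invK; apply: pres_mulV. Qed.

Lemma of_word_cat u v : of_word (u ++ v) = pres_mul (of_word u) (of_word v).
Proof.
by apply/of_wordP/pres_sym/pres_cat; apply: repr_of_word.
Qed.

Lemma of_word_repr g : of_word (repr g) = g.
Proof. by rewrite /of_word reprK. Qed.

Lemma pres_mulA : associative pres_mul.
Proof.
move=> f g h; rewrite -[f]of_word_repr -[g]of_word_repr -[h]of_word_repr.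
by rewrite -!of_word_cat catA.
Qed.

Lemma pres_mul1 : left_id pres_one pres_mul.
Proof. by move=> g; rewrite -[g]of_word_repr -of_word_cat. Qed.

Lemma pres_mulr1 : right_id pres_one pres_mul.
Proof. by move=> g; rewrite -[g]of_word_repr -of_word_cat cats0. Qed.

Lemma pres_mulVg : left_inverse pres_one pres_inv pres_mul.
Proof.
move=> g; rewrite -{2}[g]of_word_repr /pres_inv -of_word_cat.
by apply/of_wordP/pres_Vmul.
Qed.

Lemma pres_mulgV : right_inverse pres_one pres_inv pres_mul.
Proof.
move=> g; rewrite -{1}[g]of_word_repr /pres_inv -of_word_cat.
by apply/of_wordP/pres_mulV.
Qed.

HB.instance Definition _ := isGroup.Build pres_group
  pres_mulA pres_mul1 pres_mulr1 pres_mulVg pres_mulgV.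

End Presentation.

(** ** The modular group PSL_2(Z) = <a, b | a^2 = b^3 = 1>

    The generator a is [false], the generator b is [true]. *)

Definition PSL2Z_rel : set (word bool) :=
  (fun w => w = nseq 2 (false, false) \/ w = nseq 3 (true, false)).

Definition PSL2Z : groupType := pres_group PSL2Z_rel.

Definition gen_a : PSL2Z := of_word PSL2Z_rel [:: (false, false)].
Definition gen_b : PSL2Z := of_word PSL2Z_rel [:: (true, false)].

Variant letter := La | Lb | LbV.

Definition letter_val (l : letter) : PSL2Z :=
  match l with La => gen_a | Lb => gen_b | LbV => gen_b^-1 end%g.

Definition word_val (w : seq letter) : PSL2Z := (\prod_(l <- w) letter_val l)%g.

Definition is_a (l : letter) : bool := if l is La then true else false.

(** Length at most 1, or alternating a and letters in {b, b^-1}. *)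
Definition geodesic (w : seq letter) : bool :=
  sorted (fun l l' => is_a l != is_a l') w.

(** ** Subgroups and their isomorphism types *)

Section Subgroups.
Variable G : groupType.

Definition subgroup (H : set G) : Prop :=
  H 1%g /\ forall g h, H g -> H h -> H (g * h^-1)%g.

Definition finitely_generated (H : set G) : Prop :=
  exists s : seq G, (forall g, g \in s -> H g) /\
    forall K : set G, subgroup K -> (forall g, g \in s -> K g) -> (H `<=` K)%classic.

(** The free product of [r2] copies of Z_2, [r3] copies of Z_3 and a free group
    of rank [r]: the disjoint union of the presentations <x | x^2> ([r2] times),
    <y | y^3> ([r3] times) and <z_1, ..., z_r | >. *)
Definition free_product_rel (r2 r3 r : nat) : set (word ('I_r2 + 'I_r3 + 'I_r)%type) :=
  fun w => (exists i : 'I_r2, w = nseq 2 (inl (inl i), false)) \/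
           (exists j : 'I_r3, w = nseq 3 (inl (inr j), false)).

Definition free_product (r2 r3 r : nat) : groupType :=
  pres_group (@free_product_rel r2 r3 r).

Definition has_iso_type (r2 r3 r : nat) (H : set G) : Prop :=
  exists f : free_product r2 r3 r -> G,
    [/\ forall x y, f (x * y)%g = (f x * f y)%g, injective f & range f = H].

End Subgroups.

(** ** Graphs with undirected a-edges and directed b-edges

    Undirected a-edges are encoded by a symmetric relation. *)

Record abgraph (V : Type) := ABGraph {
  vertex : set V;
  aedge : V -> V -> Prop;
  bedge : V -> V -> Prop }.

Section CyclicallyReduced.
Variables (V : Type) (Gm : abgraph V).

Definition graph_connected : Prop :=
  (vertex Gm !=set0)%classic /\
  forall x y, vertex Gm x -> vertex Gm y ->
    clos_refl_sym_trans V (fun u v => aedge Gm u v \/ bedge Gm u v) x y.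

Definition well_formed : Prop :=
  [/\ forall x y, aedge Gm x y -> vertex Gm x /\ vertex Gm y,
      forall x y, bedge Gm x y -> vertex Gm x /\ vertex Gm y &
      forall x y, aedge Gm x y -> aedge Gm y x].

Definition isolated_bedge (x y : V) : Prop :=
  [/\ bedge Gm x y, x <> y &
      forall u v, bedge Gm u v -> u = x \/ u = y \/ v = x \/ v = y ->
        u = x /\ v = y].

Definition triangle_bedge (x y : V) : Prop :=
  exists z, [/\ bedge Gm x y, bedge Gm y z & bedge Gm z x] /\
            [/\ x <> y, y <> z & z <> x].

(** Since [aedge] is symmetric, a vertex lying on exactly one a-edge is exactly a
    vertex with one [aedge]-neighbour (itself in the case of an a-loop). *)
Definition cyclically_reduced : Prop :=
  [/\ well_formed, finite_set (vertex Gm), graph_connected,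
      forall x, vertex Gm x -> exists! y, aedge Gm x y &
      [/\ forall x y z, bedge Gm x y -> bedge Gm x z -> y = z,
          forall x y z, bedge Gm x z -> bedge Gm y z -> x = y,
          forall x, vertex Gm x -> exists y, bedge Gm x y \/ bedge Gm y x &
          forall x y, bedge Gm x y ->
            [\/ x = y, isolated_bedge x y | triangle_bedge x y]]].

End CyclicallyReduced.

(** ** Labeled graphs and the numbers s(n, k2, k3, l2, l3) *)

Section Labeled.
Variable n : nat.

(** The label set is ['I_n]; the two components list the a-edges (in both
    directions) and the b-edges. *)
Definition labeled_graph : finType :=
  ({set 'I_n * 'I_n} * {set 'I_n * 'I_n})%type.

Definition abgraph_of (g : labeled_graph) : abgraph 'I_n :=
  ABGraph [set: 'I_n]%classic
    (fun x y => (x, y) \in g.1) (fun x y => (x, y) \in g.2).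

Definition num_isolated_a (g : labeled_graph) : nat :=
  #|[set [set p.1; p.2] | p in g.1 & p.1 != p.2]%SET|.

Definition num_isolated_b (g : labeled_graph) : nat :=
  #|[pred p : 'I_n * 'I_n | `[< isolated_bedge (abgraph_of g) p.1 p.2 >]]|.

Definition num_loops_a (g : labeled_graph) : nat :=
  #|[pred x : 'I_n | (x, x) \in g.1]|.

Definition num_loops_b (g : labeled_graph) : nat :=
  #|[pred x : 'I_n | (x, x) \in g.2]|.

End Labeled.

Definition s_number (n : nat) (k2 k3 : int) (l2 l3 : nat) : nat :=
  #|[pred g : labeled_graph n |
      [&& `[< cyclically_reduced (abgraph_of g) >],
          Posz (num_isolated_a g) == k2, Posz (num_isolated_b g) == k3,
          num_loops_a g == l2 & num_loops_b g == l3]]|.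

(** The integer part of z / 2, also for negative z. It matters only for parities at which
    z / 2 is not an integer: for a graph with [l2 + 1] a-loops, rooted at one of them, the
    number of isolated a-edges is (n - l2 - 1) / 2, that is, [int_half (n - l2)]. *)
Definition int_half (z : int) : int := (z %/ 2)%Z.

(** ** Schreier and Stallings graphs *)

Section Stallings.
Variable H : set PSL2Z.

(** The vertex Hg of the Schreier graph. *)
Definition coset_vertex (g : PSL2Z) : set PSL2Z :=
  [set (h * g)%g | h in H]%classic.

Definition root_vertex : set PSL2Z := coset_vertex 1%g.

(** [traverses u l v]: [u ++ l :: v] labels a loop at the root and is geodesic; its
    letter [l] is read from the vertex of [u] to the vertex of [rcons u l]. *)
Definition traverses (u : seq letter) (l : letter) (v : seq letter) : Prop :=
  geodesic (u ++ l :: v) /\ H (word_val (u ++ l :: v)).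

(** The subgraph of the Schreier graph of H spanned by the loops at the root
    labeled by the geodesic representatives of the elements of H. *)
Definition stallings : abgraph (set PSL2Z) := {|
  vertex := fun x => exists u v : seq letter,
    [/\ geodesic (u ++ v), H (word_val (u ++ v)) & x = coset_vertex (word_val u)];
  aedge := fun x y => exists u v : seq letter, traverses u La v /\
    let p := coset_vertex (word_val u) in
    let q := coset_vertex (word_val (rcons u La)) in
    (x = p /\ y = q) \/ (x = q /\ y = p);
  bedge := fun x y => exists u v : seq letter,
    (traverses u Lb v /\
       x = coset_vertex (word_val u) /\
       y = coset_vertex (word_val (rcons u Lb))) \/
    (traverses u LbV v /\
       x = coset_vertex (word_val (rcons u LbV)) /\
       y = coset_vertex (word_val u)) |}.

Definition root_on_a_edge : Prop := exists x, aedge stallings root_vertex x.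

Definition root_on_b_edge : Prop :=
  exists x, bedge stallings root_vertex x \/ bedge stallings x root_vertex.

End Stallings.

Definition cyclically_reduced_subgroup (H : set PSL2Z) : Prop :=
  cyclically_reduced (stallings H).

(** Finitely generated subgroups of size [n] and isomorphism type (r2, r3, r). *)
Definition size_type_class (n r2 r3 r : nat) : set (set PSL2Z) :=
  fun H => [/\ subgroup H, finitely_generated H,
               (vertex (stallings H) #= `I_n)%card & has_iso_type r2 r3 r H].

(** Subgroups are counted, like the graphs counted by [s_number], as labeled objects: a
    subgroup of size [n] in the class [C] comes with a bijection between the label set and
    the vertices of its Stallings graph. Every subgroup of size [n] has [n`!] labelings. *)
Definition labeled_subgroups (n : nat) (C : set (set PSL2Z)) :
    set (set PSL2Z * ('I_n -> set PSL2Z)) :=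
  fun p => [/\ C p.1, injective p.2 & range p.2 = vertex (stallings p.1)].
Arguments labeled_subgroups : clear implicits.

(* Main.v *)
Require Import Defs.
From mathcomp Require Import fingroup all_boot all_order all_algebra.
From mathcomp Require Import boolp classical_sets functions cardinality.
From mathcomp Require Import zify.
From Stdlib Require Import Relation_Operators.

(** A subgroup is recovered from its rooted Stallings graph as the group of labels of
    loops at the root, so the theorem follows from three facts.

    Every vertex of a finite rooted graph whose non-root vertices all lie on an a-edge and
    on a b-edge is reached by a geodesic word of either terminal type: exchanging the ends
    of a-edges and of b-edges alternately is a permutation of the pairs (vertex, type), so
    the set of reachable pairs, closed under it, is closed under its inverse. Hence the
    graph is the Stallings graph of its loop group, and such a graph is cyclically reduced
    exactly when the root also lies on both kinds of edges. Otherwise the missing loop can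
    be added at the root, which yields the factors l3 + 1 and l2 + 1 (the choices of the
    loop).

    The isomorphism type of the loop group is read off a spanning tree of the bipartite
    graph whose nodes are the a-orbits and the b-orbits and whose edges are the vertices:
    loops give the torsion factors and the edges outside the tree give free generators.
    The map from the free product is injective because labels of paths lift to the covering
    graph on V x F, where equal elements have the same reduced word. Thus
    r + #(a-orbits) + #(b-orbits) = n + 1, which is the formula for k3.

    The triple (r2, r3, r) is an invariant, as the numbers of homomorphisms to Z/2, Z/3 and
    Z/4 are 2^(r2 + r), 3^(r3 + r) and 2^(r2 + 2 r). *)

Set Implicit Arguments.
Unset Strict Implicit.
Unset Printing Implicit Defensive.

Local Open Scope group_scope.

(** * Presented groups and normal forms *)

Section PresentedGroups.
Variables (X : choiceType) (R : set (word X)).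

(** Letters act on the states satisfying [Q], compatibly with cancellation and with the relators, so
    the final state depends only on the group element. This serves both for maps out of a
    presentation and, with geodesic words as states, for normal forms. *)
Lemma pres_eq_foldl (M : Type) (Q : M -> Prop) (act : M -> X * bool -> M) :
  (forall m l, Q m -> Q (act m l)) ->
  (forall m x e, Q m -> act (act m (x, e)) (x, ~~ e) = m) ->
  (forall r m, R r -> Q m -> foldl act m r = m) ->
  forall u v, pres_eq R u v -> forall m, Q m -> foldl act m u = foldl act m v.
Proof.
move=> actQ act_cancel act_rel.
have foldQ w m : Q m -> Q (foldl act m w).
  by elim: w m => //= l w IH m Qm; apply/IH/actQ.
move=> u v; elim=> {u v} //.
- by move=> u v _ IH m Qm; rewrite IH.
- by move=> u v w _ IHu _ IHv m Qm; rewrite IHu // IHv.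
- move=> u u' v v' _ IHu _ IHv m Qm.
  by rewrite !foldl_cat IHu // IHv //; apply: foldQ.
- by move=> x e m Qm; apply: act_cancel.
- by move=> r Rr m Qm; apply: act_rel.
Qed.

Lemma pres_group_word (g : pres_group R) : exists w, g = of_word R w.
Proof. by exists (repr g); rewrite of_word_repr. Qed.

Lemma of_wordM u v : of_word R (u ++ v) = of_word R u * of_word R v.
Proof. exact: of_word_cat. Qed.

Lemma of_word_gen_cancel x e :
  of_word R [:: (x, e)] * of_word R [:: (x, ~~ e)] = 1.
Proof. by rewrite -of_wordM; apply/of_wordP/pres_cancel. Qed.

Lemma of_word_genV x : of_word R [:: (x, true)] = (of_word R [:: (x, false)])^-1.
Proof. by apply/esym/mulg1_eq/of_word_gen_cancel. Qed.

Lemma of_word_rel r : R r -> of_word R r = 1.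
Proof. by move=> Rr; apply/of_wordP/pres_rel. Qed.

Section Lift.
Variables (K : groupType) (f : X -> K).

Definition gen_value (l : X * bool) : K := if l.2 then (f l.1)^-1 else f l.1.

Definition word_image (w : word X) : K := \prod_(l <- w) gen_value l.

(** The universal property of the presentation: computed on a chosen representative, this is a
    homomorphism once [f] kills the relators ([fR]). *)
Definition pres_lift (g : pres_group R) : K := word_image (repr g).

Lemma foldl_word_image w m : foldl (fun m l => m * gen_value l) m w = m * word_image w.
Proof.
rewrite /word_image; elim: w m => [|l w IH] m /=; first by rewrite big_nil mulg1.
by rewrite IH big_cons mulgA.
Qed.

Hypothesis fR : forall r, R r -> word_image r = 1.

Lemma pres_lift_of_word w : pres_lift (of_word R w) = word_image w.
Proof.
rewrite /pres_lift -[LHS]mul1g -[RHS]mul1g -!foldl_word_image.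
apply: (@pres_eq_foldl K (fun=> True)) => //; last exact: repr_of_word.
- by move=> m x [] _; rewrite /gen_value /= ?mulgK ?mulgVK.
- by move=> r m Rr _; rewrite foldl_word_image fR // mulg1.
Qed.

Lemma pres_liftM g h : pres_lift (g * h) = pres_lift g * pres_lift h.
Proof.
have [u ->] := pres_group_word g; have [v ->] := pres_group_word h.
by rewrite -of_wordM !pres_lift_of_word /word_image big_cat.
Qed.

Lemma pres_lift_gen x : pres_lift (of_word R [:: (x, false)]) = f x.
Proof. by rewrite pres_lift_of_word /word_image big_seq1. Qed.

End Lift.

Lemma mulgM1 (G K : groupType) (f : G -> K) :
  (forall x y, f (x * y) = f x * f y) -> f 1 = 1.
Proof. by move=> fM; apply: (mulgI (f 1)); rewrite -fM !mulg1. Qed.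

Lemma mulgMV (G K : groupType) (f : G -> K) :
  (forall x y, f (x * y) = f x * f y) -> forall x, f x^-1 = (f x)^-1.
Proof. by move=> fM x; apply/esym/mulg1_eq; rewrite -fM mulgV (mulgM1 fM). Qed.

Lemma pres_ind (P : pres_group R -> Prop) :
  P 1 -> (forall g h, P g -> P h -> P (g * h)) -> (forall g, P g -> P g^-1) ->
  (forall x, P (of_word R [:: (x, false)])) -> forall g, P g.
Proof.
move=> P1 PM PV Pgen g; have [w ->] := pres_group_word g.
elim: w => [|[x e] w IH]; first exact: P1.
rewrite -cat1s of_wordM; apply: PM => //.
by case: e; rewrite ?of_word_genV; [apply/PV|]; apply: Pgen.
Qed.

Lemma pres_hom_ext (K : groupType) (f g : pres_group R -> K) :
  (forall x y, f (x * y) = f x * f y) -> (forall x y, g (x * y) = g x * g y) ->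
  (forall x, f (of_word R [:: (x, false)]) = g (of_word R [:: (x, false)])) ->
  f =1 g.
Proof.
move=> fM gM fg; elim/pres_ind => [|x y IHx IHy|x IHx|//].
- by rewrite (mulgM1 fM) (mulgM1 gM).
- by rewrite fM gM IHx IHy.
- by rewrite (mulgMV fM) (mulgMV gM) IHx.
Qed.

End PresentedGroups.

(** * Geodesic words as normal forms in the modular group *)

Section NormalForm.

Lemma gen_a2 : gen_a * gen_a = 1.
Proof. by rewrite /gen_a -of_wordM; apply: of_word_rel; left. Qed.

Lemma gen_b3 : gen_b * gen_b * gen_b = 1.
Proof.
rewrite -(@of_word_rel _ PSL2Z_rel (nseq 3 (true, false))); last by right.
by rewrite -mulgA -[nseq _ _]/([:: _] ++ [:: _] ++ [:: _]) !of_wordM.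
Qed.

Lemma gen_aV : gen_a^-1 = gen_a.
Proof. by apply: mulg1_eq gen_a2. Qed.

Lemma gen_bb : gen_b * gen_b = gen_b^-1.
Proof. by apply/esym/mulg1_eq; rewrite mulgA gen_b3. Qed.

Lemma gen_bVbV : gen_b^-1 * gen_b^-1 = gen_b.
Proof. by rewrite -gen_bb mulgA gen_b3 mul1g. Qed.

Definition letter_inv (l : letter) : letter :=
  match l with La => La | Lb => LbV | LbV => Lb end.

Lemma is_a_inv l : is_a (letter_inv l) = is_a l. Proof. by case: l. Qed.

Lemma letter_val_inv l : letter_val (letter_inv l) = (letter_val l)^-1.
Proof. by case: l; rewrite /= ?invgK // gen_aV. Qed.

Definition lword_inv (w : seq letter) : seq letter := rev (map letter_inv w).

Lemma lword_inv_cat u v : lword_inv (u ++ v) = lword_inv v ++ lword_inv u.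
Proof. by rewrite /lword_inv map_cat rev_cat. Qed.

Lemma lword_inv_cons l w : lword_inv (l :: w) = rcons (lword_inv w) (letter_inv l).
Proof. by rewrite /lword_inv /= rev_cons. Qed.

Lemma word_val_nil : word_val [::] = 1.
Proof. by rewrite /word_val big_nil. Qed.

Lemma word_val_cons l w : word_val (l :: w) = letter_val l * word_val w.
Proof. by rewrite /word_val big_cons. Qed.

Lemma word_val_cat u v : word_val (u ++ v) = word_val u * word_val v.
Proof. by rewrite /word_val big_cat. Qed.

Lemma word_val_rcons w l : word_val (rcons w l) = word_val w * letter_val l.
Proof. by rewrite -cats1 word_val_cat word_val_cons word_val_nil mulg1. Qed.

Lemma word_val_inv w : word_val (lword_inv w) = (word_val w)^-1.
Proof.
elim: w => [|l w IH]; first by rewrite word_val_nil invg1.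
by rewrite lword_inv_cons word_val_rcons IH word_val_cons letter_val_inv invgM.
Qed.

Definition letter_code (l : letter) : bool * bool :=
  match l with La => (false, false) | Lb => (true, false) | LbV => (true, true) end.

Lemma word_val_code w : word_val w = of_word PSL2Z_rel (map letter_code w).
Proof.
elim: w => [|l w IH]; first exact: word_val_nil.
rewrite word_val_cons /= -cat1s of_wordM -IH; congr (_ * _).
by case: l; rewrite //= /gen_b -of_word_genV.
Qed.

Lemma word_val_surj g : exists w, word_val w = g.
Proof.
have [w ->] := pres_group_word g; elim: w => [|[x e] w [w' IH]].
  by exists [::]; exact: word_val_nil.
exists ((if x then if e then LbV else Lb else La) :: w').
rewrite word_val_cons IH -(cat1s (x, e)) of_wordM; congr (_ * _).
by case: x; case: e => //=; rewrite of_word_genV // -gen_aV.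
Qed.

(* [push s l] multiplies on the right by [l] the geodesic word whose reversal is [s]. *)
Definition push (s : seq letter) (l : letter) : seq letter :=
  match l, s with
  | La, La :: s' => s'
  | Lb, Lb :: s' => LbV :: s'
  | Lb, LbV :: s' => s'
  | LbV, LbV :: s' => Lb :: s'
  | LbV, Lb :: s' => s'
  | _, _ => l :: s
  end.

Lemma geodesic_rev s : geodesic (rev s) = geodesic s.
Proof.
rewrite /geodesic rev_sorted; case: s => //= l s; elim: s l => //= l' s IH l.
by rewrite IH eq_sym.
Qed.

Lemma geodesic_inv w : geodesic (lword_inv w) = geodesic w.
Proof.
rewrite /lword_inv geodesic_rev /geodesic sorted_map.
by apply: eq_sorted => l l' /=; rewrite !is_a_inv.
Qed.

Lemma geodesic_push s l : geodesic s -> geodesic (push s l).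
Proof.
by case: l s => [] [|[] [|[] s]].
Qed.

Lemma push_inv s l : geodesic s -> push (push s l) (letter_inv l) = s.
Proof. by case: l s => [] [|[] [|[] s]]. Qed.

(** Together with [push_inv], this makes the letters act on geodesic words by permutations
    satisfying a^2 = b^3 = 1, as van der Waerden's argument requires. *)
Lemma push_rot s : geodesic s -> push (push (push s Lb) Lb) Lb = s.
Proof. by case: s => [|[] [|[] s]]. Qed.

Definition reduce (w : seq letter) : seq letter := rev (foldl push [::] w).

Lemma geodesic_foldl_push w s : geodesic s -> geodesic (foldl push s w).
Proof. by elim: w s => //= l w IH s gs; apply/IH/geodesic_push. Qed.

Lemma geodesic_reduce w : geodesic (reduce w).
Proof. by rewrite geodesic_rev geodesic_foldl_push. Qed.

Lemma word_val_push s l : word_val (rev (push s l)) = word_val (rev s) * letter_val l.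
Proof.
by case: l s => [] [|[] s]; rewrite /= !(rev_cons, word_val_rcons) //=;
  rewrite -?mulgA ?gen_a2 ?gen_bb ?gen_bVbV ?mulgV ?mulVg ?mulg1.
Qed.

Lemma word_val_reduce w : word_val (reduce w) = word_val w.
Proof.
rewrite /reduce; suff H s : word_val (rev (foldl push s w)) = word_val (rev s) * word_val w.
  by rewrite H word_val_nil mul1g.
elim: w s => [|l w IH] s /=; first by rewrite word_val_nil mulg1.
by rewrite IH word_val_push word_val_cons mulgA.
Qed.

Lemma reduce_id w : geodesic w -> reduce w = w.
Proof.
rewrite -{1}[w]revK geodesic_rev /reduce => gw.
suff -> : foldl push [::] w = rev w by rewrite revK.
rewrite -{1}[w]revK; move: gw; elim: (rev w) => // l s IH gs.
rewrite rev_cons foldl_rcons IH; last exact: path_sorted gs.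
by case: l s gs {IH} => [] [|[] s].
Qed.

(** Van der Waerden's trick: the group acts on geodesic words through [push], and [reduce] is, up to
    reversal, the orbit map at the empty word. As [reduce] fixes geodesic words, geodesic
    representatives are unique. *)
Lemma reduce_eq w w' : word_val w = word_val w' -> reduce w = reduce w'.
Proof.
rewrite !word_val_code => /of_wordP; rewrite /reduce => eq_w; congr rev.
(* Both a and its formal inverse are decoded as [La], since a is an involution. *)
pose decode (l : bool * bool) := if l.1 then if l.2 then LbV else Lb else La.
have codeK u s : foldl push s u = foldl (fun m l => push m (decode l)) s (map letter_code u).
  by elim: u s => //= -[] u IH s; rewrite IH.
rewrite !codeK; apply: (pres_eq_foldl (Q := geodesic)) eq_w [::] _ => //.
- by move=> m l; apply: geodesic_push.
- move=> m [] [] gm; [exact: (push_inv LbV gm)|exact: (push_inv Lb gm)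
    |exact: (push_inv La gm)|exact: (push_inv La gm)].
- by move=> r m [] -> gm; rewrite /decode /=; [apply: (push_inv La gm)|apply: push_rot].
Qed.

(** The default letter [La] is never consulted: the [nilp] disjuncts cover the empty words. *)
Lemma geodesic_cat u v : geodesic (u ++ v) =
  [&& geodesic u, geodesic v &
      nilp u || nilp v || (is_a (last La u) != is_a (head La v))].
Proof.
case: u v => [|l u] [|l' v]; rewrite ?cats0 ?andbT //.
by rewrite /geodesic /= cat_path /=; congr (_ && _); rewrite andbC.
Qed.

Lemma geodesic_mid u l v : geodesic (u ++ l :: v) =
  [&& geodesic u, geodesic v, nilp u || (is_a (last La u) != is_a l) &
      nilp v || (is_a l != is_a (head La v))].
Proof.
rewrite geodesic_cat -cat1s geodesic_cat /= orbF; congr (_ && _).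
by rewrite -andbA; congr (_ && _); rewrite andbC.
Qed.

End NormalForm.

(** * Reading words in a graph *)

Section Reading.
Variables (V : Type) (ea eb : V -> V -> Prop).

Definition ledge (l : letter) (x y : V) : Prop :=
  match l with La => ea x y | Lb => eb x y | LbV => eb y x end.

Fixpoint reads (w : seq letter) (x y : V) : Prop :=
  if w is l :: w' then exists2 z, ledge l x z & reads w' z y else x = y.

(** The local conditions of a partial Schreier graph. [eb_triangle] expresses b^3 = 1 while still
    allowing isolated b-edges, since it closes only paths of two b-edges. *)
Record folded : Prop := Folded {
  ea_sym : forall x y, ea x y -> ea y x;
  ea_fun : forall x y z, ea x y -> ea x z -> y = z;
  eb_fun : forall x y z, eb x y -> eb x z -> y = z;
  eb_inj : forall x y z, eb x z -> eb y z -> x = y;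
  eb_triangle : forall x y z, eb x y -> eb y z -> eb z x }.

Lemma reads_cat u v x y :
  reads (u ++ v) x y <-> exists2 z, reads u x z & reads v z y.
Proof.
elim: u x => [|l u IH] x /=.
  by split=> [r|[z -> //]]; exists x.
split=> [[z lxz /IH[t utz vty]]|[t [z lxz uzt] vty]].
  by exists t => //; exists z.
by exists z => //; apply/IH; exists t.
Qed.

Lemma reads_rcons u l x y :
  reads (rcons u l) x y <-> exists2 z, reads u x z & ledge l z y.
Proof.
rewrite -cats1 reads_cat /=.
by split=> [] [z uxz] => [[t lzt <-]|lzy]; exists z => //; exists y.
Qed.

Hypothesis fd : folded.

Lemma ledge_inv l x y : ledge l x y -> ledge (letter_inv l) y x.
Proof. by case: l => //=; apply: (ea_sym fd). Qed.

Lemma ledge_fun l x y z : ledge l x y -> ledge l x z -> y = z.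
Proof. by case: l => /=; [apply: (ea_fun fd)|apply: (eb_fun fd)|apply: (eb_inj fd)]. Qed.

Lemma reads_inv w x y : reads w x y -> reads (lword_inv w) y x.
Proof.
elim: w x => [|l w IH] x /=; first by move->.
move=> [z lxz /IH wyz]; rewrite lword_inv_cons reads_rcons.
by exists z => //; apply: ledge_inv.
Qed.

Lemma reads_fun w x y z : reads w x y -> reads w x z -> y = z.
Proof.
elim: w x => [|l w IH] x /=; first by move=> <-.
by move=> [t lxt wty] [t' lxt' wtz]; rewrite (ledge_fun lxt' lxt) in wtz; apply: IH wtz.
Qed.

(** A cancellation goes back along the edge just read, and the replacement of b b by b^-1 uses the
    edge supplied by [eb_triangle]; so reduction never leaves the graph. *)
Lemma reads_push s l x y :
  reads (rcons (rev s) l) x y -> reads (rev (push s l)) x y.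
Proof.
move=> r; case: s r => [|l' s]; first by case: l.
rewrite rev_cons => r; have /reads_rcons[z /reads_rcons[t st l'tz] lzy] := r.
have cancel : letter_inv l' = l -> reads (rev s) x y.
  by move=> ll; have := ledge_inv l'tz; rewrite ll => /ledge_fun/(_ lzy) <-.
have turn : l' = l -> ~~ is_a l -> reads (rev (letter_inv l :: s)) x y.
  move=> ll; rewrite {}ll in l'tz => la; rewrite rev_cons reads_rcons; exists t => //.
  by case: l la l'tz lzy {r cancel} => //= _ h1 h2; apply: eb_triangle; eauto.
by case: l l' r l'tz lzy cancel turn => [] [] //= r l'tz lzy cancel turn;
  rewrite ?rev_cons //; (try exact: cancel); (try exact: turn);
  rewrite -?rev_cons; exact: turn.
Qed.

Lemma reads_reduce w x y : reads w x y -> reads (reduce w) x y.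
Proof.
rewrite /reduce; suff H s : reads (rev s ++ w) x y -> reads (rev (foldl push s w)) x y.
  by apply: (H [::]).
elim: w s => [|l w IH] s /=; first by rewrite cats0.
rewrite -cat_rcons => /reads_cat[z rz wzy]; apply: IH.
by apply/reads_cat; exists z => //; apply: reads_push.
Qed.

(** Both words reduce to the same geodesic, which can still be read from x, and reading is
    deterministic. *)
Lemma reads_val_fun w w' x y z :
  word_val w = word_val w' -> reads w x y -> reads w' x z -> y = z.
Proof.
by move=> /reduce_eq eq_w /reads_reduce + /reads_reduce; rewrite eq_w; apply: reads_fun.
Qed.

End Reading.

Arguments reads {V} ea eb w x y.

(** * Loop groups and the cosets represented by vertices *)

Section LoopGroup.
Variables (V : Type) (ea eb : V -> V -> Prop) (v0 : V).
Hypothesis fd : folded ea eb.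

Definition path_class (x : V) : set PSL2Z :=
  [set g | exists2 w, reads ea eb w v0 x & word_val w = g]%classic.

Definition loop_group : set PSL2Z := path_class v0.

Lemma loop_group_subgroup : subgroup loop_group.
Proof.
split; first by exists [::] => //; exact: word_val_nil.
move=> _ _ [u ru <-] [v rv <-]; exists (u ++ lword_inv v).
  by apply/reads_cat; exists v0 => //; apply: reads_inv.
by rewrite word_val_cat word_val_inv.
Qed.

(** Any witness of membership reduces to [w], and a reduced word can still be read. *)
Lemma path_class_reads w x :
  geodesic w -> path_class x (word_val w) -> reads ea eb w v0 x.
Proof.
by move=> gw [u /(reads_reduce fd) ru /reduce_eq eq_u]; rewrite eq_u reduce_id in ru.
Qed.

Lemma coset_path_class w x :
  reads ea eb w v0 x -> coset_vertex loop_group (word_val w) = path_class x.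
Proof.
move=> wx; apply/seteqP; split=> [_ [_ [u ru <-] <-]|_ [u ru <-]].
  by exists (u ++ w); rewrite ?word_val_cat //; apply/reads_cat; exists v0.
exists (word_val u * (word_val w)^-1); last by rewrite mulgVK.
exists (u ++ lword_inv w); last by rewrite word_val_cat word_val_inv.
by apply/reads_cat; exists x => //; apply: reads_inv.
Qed.

Lemma path_class_inj x y w :
  reads ea eb w v0 x -> path_class x = path_class y -> x = y.
Proof.
move=> wx eqxy; have : path_class y (word_val w) by rewrite -eqxy; exists w.
by case=> u uy eq_u; apply: (reads_val_fun fd (esym eq_u) wx uy).
Qed.

End LoopGroup.

(** * Geodesic loops and Stallings graphs *)

Definition on_edge (V : Type) (e : V -> V -> Prop) (x : V) : Prop :=
  exists y, e x y \/ e y x.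

Record rooted_graph (V : Type) (ea eb : V -> V -> Prop) (v0 : V) : Prop := RootedGraph {
  rooted_folded : folded ea eb;
  rooted_reads : forall x, exists w, reads ea eb w v0 x;
  rooted_on_a : forall x, x <> v0 -> on_edge ea x;
  rooted_on_b : forall x, x <> v0 -> on_edge eb x }.

(** On a finite type the inverse of an injection is one of its iterates. *)
Lemma inj_closed_back (T : finType) (f : T -> T) (Q : T -> Prop) :
  injective f -> (forall x, Q x -> Q (f x)) -> forall x, Q (f x) -> Q x.
Proof.
move=> f_inj Qf x Qfx; rewrite -[x](finv_f f_inj) /finv.
by elim: (_.-1) => //= k; apply: Qf.
Qed.

Section GeodesicLoops.
Variables (V : finType) (ea eb : rel V) (v0 : V).
Hypothesis rg : rooted_graph ea eb v0.

Let fd := rooted_folded rg.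

(** On a folded graph this exchanges the ends of an isolated edge, rotates a triangle, and fixes a
    vertex on no edge. *)
Definition flip (e : rel V) (x : V) : V :=
  if [pick y | e x y] is Some y then y
  else if [pick y | e y x] is Some y then y else x.

Lemma flip_cases (e : rel V) x : [\/ e x (flip e x),
  e (flip e x) x /\ forall y, ~ e x y | flip e x = x /\ ~ on_edge e x].
Proof.
rewrite /flip; case: pickP => [y exy|no_out]; first by constructor 1.
case: pickP => [y eyx|no_in]; first by constructor 2; split=> // z; rewrite no_out.
by constructor 3; split=> // -[y []]; rewrite ?no_out ?no_in.
Qed.

Lemma flip_out (e : rel V) x y : (forall x y z, e x y -> e x z -> y = z) ->
  e x y -> flip e x = y.
Proof.
move=> e_fun exy; rewrite /flip; case: pickP => [z exz|/(_ y)]; last by rewrite exy.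
exact: e_fun exz exy.
Qed.

(** The critical collision is between a step along an edge out of x and a step back from y: it gives
    a path from x to y of two edges with no edge out of y, which the third hypothesis forbids. *)
Lemma flip_inj (e : rel V) : (forall x y z, e x y -> e x z -> y = z) ->
  (forall x y z, e x z -> e y z -> x = y) ->
  (forall x y z, e x y -> e y z -> exists t, e z t) -> injective (flip e).
Proof.
move=> e_fun e_inj e_next x y fxy.
have [xo|[xi nox]|[xx nx]] := flip_cases e x; have [yo|[yi noy]|[yy ny]] := flip_cases e y.
- by apply: e_inj xo _; rewrite fxy.
- by rewrite -fxy in yi; have [s /noy] := e_next _ _ _ xo yi.
- by case: ny; exists x; right; rewrite -yy -fxy.
- by rewrite fxy in xi; have [s /nox] := e_next _ _ _ yo xi.
- by apply: e_fun xi _; rewrite fxy.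
- by case: ny; exists x; left; rewrite -{1}yy -fxy.
- by case: nx; exists y; right; rewrite -xx fxy.
- by case: nx; exists y; left; rewrite -{1}xx fxy.
- by rewrite -xx fxy.
Qed.

Lemma flip_ea_inj : injective (flip ea).
Proof.
apply: flip_inj => [x y z|x y z xz yz|x y z _ yz]; first exact: (ea_fun fd).
  by apply: (ea_fun fd) (ea_sym fd yz); apply: (ea_sym fd).
by exists y; apply: (ea_sym fd).
Qed.

Lemma flip_eb_inj : injective (flip eb).
Proof.
apply: flip_inj => [x y z|x y z|x y z xy yz]; first exact: (eb_fun fd).
  exact: (eb_inj fd).
by exists x; apply: (eb_triangle fd) yz.
Qed.

Lemma flip_ea_edge x : x <> v0 -> ea x (flip ea x).
Proof.
move=> xv; case: (flip_cases ea x) => [//|[/(ea_sym fd)//]|[_ []]].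
exact: rooted_on_a rg _ xv.
Qed.

Lemma flip_eb_edge x : x <> v0 -> eb x (flip eb x) \/ eb (flip eb x) x.
Proof.
move=> xv; case: (flip_cases eb x) => [|[]|[_ []]]; [by left|by right|].
exact: rooted_on_b rg _ xv.
Qed.

(* At the root, the empty word fits both types. *)
Definition geodesic_to (x : V) (c : bool) : Prop :=
  exists w, [/\ geodesic w, reads ea eb w v0 x & nilp w \/ is_a (last La w) = c].

Lemma geodesic_to_root c : geodesic_to v0 c.
Proof. by exists [::]; split=> //; left. Qed.

Lemma geodesic_to_step x l y :
  geodesic_to x (~~ is_a l) -> ledge ea eb l x y -> geodesic_to y (is_a l).
Proof.
move=> [w [gw rw wl]] lxy; exists (rcons w l); split; last 1 first.
- by right; rewrite last_rcons.
- rewrite -cats1 geodesic_cat gw /= orbF.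
  by case: wl => ->; rewrite ?orbT //; case: l {lxy}; rewrite ?orbT.
- by apply/reads_rcons; exists x.
Qed.

(* The second component is the type of the last letter read. *)
Definition alternate (f : V -> V) (s : V * bool) : V * bool :=
  if s.2 then (f s.1, false) else (flip ea s.1, true).

Lemma alternate_inj f : injective f -> injective (alternate f).
Proof.
move=> f_inj [x c] [y c']; rewrite /alternate /=.
by case: c; case: c' => //= -[]; [move/f_inj->|move/flip_ea_inj->].
Qed.

(** The map [f] is kept general because both [flip eb] and its inverse are needed. A vertex that is
    not moved along an edge is the root, where the empty word has both types. *)
Lemma alternate_geodesic f :
  (forall x, x <> v0 -> eb x (f x) \/ eb (f x) x) ->
  (f v0 = v0 \/ eb v0 (f v0) \/ eb (f v0) v0) ->
  forall s, geodesic_to s.1 s.2 -> geodesic_to (alternate f s).1 (alternate f s).2.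
Proof.
move=> f_edge f_root [x []] /= gx.
- have : x = v0 /\ f x = v0 \/ eb x (f x) \/ eb (f x) x.
    have [->|/eqP/f_edge] := eqVneq x v0; last by right.
    by case: f_root; [left|right].
  move=> [[_ ->]|]; first exact: geodesic_to_root.
  by case; [apply: (@geodesic_to_step x Lb)|apply: (@geodesic_to_step x LbV)].
- have : x = v0 /\ flip ea x = v0 \/ ea x (flip ea x).
    have [->|/eqP/flip_ea_edge] := eqVneq x v0; last by right.
    by case: (flip_cases ea v0) => [|[/(ea_sym fd)]|[-> _]]; [right|right|left].
  move=> [[_ ->]|]; first exact: geodesic_to_root.
  exact: (@geodesic_to_step x La).
Qed.

Lemma geodesic_to_all x : geodesic_to x true /\ geodesic_to x false.
Proof.
pose f := flip eb; pose f' := finv f.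
have f_inj : injective f := flip_eb_inj.
have f'_inj : injective f' by apply: finv_inj.
have fK : cancel f f' := finv_f f_inj.
have f'K : cancel f' f := f_finv f_inj.
have f_root : f v0 = v0 \/ eb v0 (f v0) \/ eb (f v0) v0.
  by case: (flip_cases eb v0) => [|[]|[]]; rewrite -/f; auto.
have fwd : forall s, geodesic_to s.1 s.2 ->
    geodesic_to (alternate f s).1 (alternate f s).2.
  by apply: alternate_geodesic f_root => y /flip_eb_edge.
have fwd' : forall s, geodesic_to s.1 s.2 ->
    geodesic_to (alternate f' s).1 (alternate f' s).2.
  apply: alternate_geodesic => [y yv|].
    case: (eqVneq (f' y) v0) => [fy|/eqP/flip_eb_edge]; last by rewrite -/f f'K; tauto.
    have fv : f v0 = y by rewrite -fy f'K.
    by move: f_root; rewrite fy fv; case=> [/yv|]; tauto.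
  case: (eqVneq (f' v0) v0) => [|/eqP/flip_eb_edge]; first by left.
  by rewrite -/f f'K; tauto.
have back s : geodesic_to (alternate f s).1 (alternate f s).2 -> geodesic_to s.1 s.2.
  exact: (inj_closed_back (alternate_inj f_inj) fwd).
have back' s : geodesic_to (alternate f' s).1 (alternate f' s).2 -> geodesic_to s.1 s.2.
  exact: (inj_closed_back (alternate_inj f'_inj) fwd').
have [w] := rooted_reads rg x.
elim/last_ind: w x => [|w l IH] x; first by move=> <-; split; apply: geodesic_to_root.
case/reads_rcons => y /IH [yt yf] lyx.
(* Appending [l] to a geodesic word for y gives one type at x. The other is pulled back from y along
   a step of the permutation carrying x to y: the one built on [f'] when the b-edge enters x,
   otherwise the one built on [f]. *)
case: l lyx => lyx.
- split; first exact: (@geodesic_to_step y La).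
  apply: (back (x, false)); rewrite /alternate /= (flip_out _ (y := y)) //.
    exact: (ea_fun fd).
  exact: (ea_sym fd).
- split; last exact: (@geodesic_to_step y Lb).
  apply: (back' (x, true)); rewrite /alternate /=.
  by rewrite -(flip_out (eb_fun fd) lyx) -/f fK.
- split; last exact: (@geodesic_to_step y LbV).
  apply: (back (x, true)); rewrite /alternate /=.
  by rewrite /f (flip_out (eb_fun fd) lyx).
Qed.

Lemma geodesic_to_inv x c : exists w,
  [/\ geodesic w, reads ea eb w x v0 & nilp w \/ is_a (head La w) = c].
Proof.
have [w [gw rw wc]] : geodesic_to x c by case: c; case: (geodesic_to_all x).
exists (lword_inv w); split; [by rewrite geodesic_inv|exact: (reads_inv fd)|].
case: wc; first by case: w {gw rw} => //=; left.
case/lastP: w {gw rw} => [|w l]; first by left.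
by rewrite last_rcons /lword_inv map_rcons rev_rcons /= is_a_inv; right.
Qed.

(** Arriving by an a-letter and leaving by a b-letter keeps the concatenation geodesic; an empty
    half imposes nothing. *)
Lemma vertex_on_geodesic_loop x : exists u v,
  [/\ geodesic (u ++ v), reads ea eb u v0 x & reads ea eb v x v0].
Proof.
have [[u [gu ru ut]] _] := geodesic_to_all x.
have [v [gv rv vf]] := geodesic_to_inv x false.
exists u, v; split=> //; rewrite geodesic_cat gu gv /=.
by case: ut => [->//|->]; case: vf => ->; rewrite ?orbT.
Qed.

Lemma edge_on_geodesic_loop x l y : ledge ea eb l x y -> exists u v,
  [/\ geodesic (u ++ l :: v), reads ea eb u v0 x & reads ea eb v y v0].
Proof.
move=> lxy; have [u [gu ru ul]] : geodesic_to x (~~ is_a l).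
  by case: (is_a l); case: (geodesic_to_all x).
have [v [gv rv vl]] := geodesic_to_inv y (~~ is_a l).
exists u, v; split=> //; rewrite geodesic_cat gu -cat1s geodesic_cat gv /= orbF.
by case: vl => ->; case: ul => ->; rewrite ?orbT //; case: (is_a l); rewrite ?orbT.
Qed.

(** * The Stallings graph of the loop group *)

Let L := loop_group ea eb v0.
Let lam := path_class ea eb v0.

Lemma path_class_graph_inj : injective lam.
Proof. by move=> x y; have [w rw] := rooted_reads rg x; apply: path_class_inj rw. Qed.

Lemma path_class_root : root_vertex L = lam v0.
Proof.
rewrite /root_vertex -word_val_nil; exact: (coset_path_class fd (w := [::])).
Qed.

Lemma loop_reads u l v : traverses L u l v -> exists x y,
  [/\ reads ea eb u v0 x, ledge ea eb l x y & reads ea eb (rcons u l) v0 y].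
Proof.
move=> [guv /(path_class_reads fd guv)/reads_cat[x ux [y lxy _]]].
by exists x, y; split=> //; apply/reads_rcons; exists x.
Qed.

Lemma traverses_edge x l y : ledge ea eb l x y -> exists u v,
  [/\ traverses L u l v, lam x = coset_vertex L (word_val u) &
      lam y = coset_vertex L (word_val (rcons u l))].
Proof.
move=> lxy; have [u [v [g ru rv]]] := edge_on_geodesic_loop lxy.
exists u, v; split; last 2 first.
- by rewrite (coset_path_class fd ru).
- by rewrite (@coset_path_class _ _ _ _ fd _ y) //; apply/reads_rcons; exists x.
- split=> //; exists (u ++ l :: v) => //.
  by apply/reads_cat; exists x => //; exists y.
Qed.

(** With [stallings_aedge] and [stallings_bedge], this makes [lam] an isomorphism onto the Stallings
    graph. Vertices and edges count there only if a geodesic loop passes through them, whence the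
    preceding lemmas. *)
Lemma stallings_vertex c : vertex (stallings L) c <-> exists x, c = lam x.
Proof.
split=> [[u [v [guv Luv ->]]]|[x ->]].
  have /reads_cat[x ux _] := path_class_reads fd guv Luv.
  by exists x; rewrite (coset_path_class fd ux).
have [u [v [guv ru rv]]] := vertex_on_geodesic_loop x.
exists u, v; split=> //; last by rewrite (coset_path_class fd ru).
by exists (u ++ v) => //; apply/reads_cat; exists x.
Qed.

Lemma stallings_aedge x y : aedge (stallings L) (lam x) (lam y) <-> ea x y.
Proof.
split=> [[u [v [/loop_reads[x' [y' [ux lxy uy]]] /= []]]]|exy].
- rewrite (coset_path_class fd ux) (coset_path_class fd uy).
  by move=> [/path_class_graph_inj-> /path_class_graph_inj->].
- rewrite (coset_path_class fd ux) (coset_path_class fd uy).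
  by move=> [/path_class_graph_inj-> /path_class_graph_inj->]; apply: (ea_sym fd).
have [u [v [t xu yu]]] := @traverses_edge x La y exy.
by exists u, v; split=> //; left.
Qed.

Lemma stallings_bedge x y : bedge (stallings L) (lam x) (lam y) <-> eb x y.
Proof.
split=> [[u [v []]] [/loop_reads[x' [y' [ux lxy uy]]] []]|exy].
- rewrite (coset_path_class fd ux) (coset_path_class fd uy).
  by move=> /path_class_graph_inj-> /path_class_graph_inj->.
- rewrite (coset_path_class fd ux) (coset_path_class fd uy).
  by move=> /path_class_graph_inj-> /path_class_graph_inj->.
have [u [v [t xu yu]]] := @traverses_edge x Lb y exy.
by exists u, v; left.
Qed.

End GeodesicLoops.

(** * The isomorphism type of the loop group *)

Section SpanningTree.
Variables (E N : finType) (src tgt : E -> N) (e0 : E).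

(** Subtrees grown from the node [src e0] by pendant edges, with edges of [E] taken as undirected.
    Growth by single edges is what lets the potentials below be built by induction. *)
Inductive tree : {set N} -> {set E} -> Prop :=
| tree_root : tree [set src e0] finset.set0
| tree_tgt S T e : tree S T -> src e \in S -> tgt e \notin S ->
    tree (tgt e |: S) (e |: T)
| tree_src S T e : tree S T -> tgt e \in S -> src e \notin S ->
    tree (src e |: S) (e |: T).

Lemma tree_ends S T e : tree S T -> e \in T -> (src e \in S) && (tgt e \in S).
Proof.
elim=> {S T} [|S T f _ IH sf tf|S T f _ IH tf sf]; rewrite !inE //.
all: by case/orP => [/eqP->|/IH/andP[-> ->]]; rewrite ?sf ?tf ?eqxx !orbT.
Qed.

Lemma tree_root_mem S T : tree S T -> src e0 \in S.
Proof. by elim=> {S T} [|S T f _ IH *|S T f _ IH *]; rewrite !inE // IH orbT. Qed.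

Lemma tree_card S T : tree S T -> #|S| = #|T|.+1.
Proof.
elim=> {S T} [|S T f tr IH sf tf|S T f tr IH tf sf]; first by rewrite cards1 cards0.
- rewrite !cardsU1 IH tf; suff -> : f \notin T by [].
  by apply/negP => /(tree_ends tr); rewrite (negPf tf) andbF.
- rewrite !cardsU1 IH sf; suff -> : f \notin T by [].
  by apply/negP => /(tree_ends tr); rewrite (negPf sf).
Qed.

Lemma tree_sub S T : tree S T -> S \subset src @: E :|: tgt @: E.
Proof.
elim=> {S T} [|S T f _ IH sf tf|S T f _ IH tf sf].
- by rewrite finset.sub1set inE imset_f.
all: by rewrite finset.subUset finset.sub1set IH inE imset_f ?orbT.
Qed.

(** The tree grows as long as some edge leaves [S], and the complement of [S] shrinks each time. In
    a connected graph such an [S] contains every node. *)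
Lemma spanning_tree : exists S T, tree S T /\ forall e, (src e \in S) = (tgt e \in S).
Proof.
suff H k S T : tree S T -> #|~: S| <= k -> exists S T,
    tree S T /\ forall e, (src e \in S) = (tgt e \in S).
  by apply: (H _ _ _ tree_root (leqnn _)).
elim: k S T => [|k IH] S T tr.
  rewrite leqn0 cards_eq0 => /eqP S0; exists S, T; split=> // e.
  have all_in x : x \in S by have := finset.in_set0 x; rewrite -S0 inE => /negbFE.
  by rewrite !all_in.
move=> Sk; have grow x : x \notin S -> #|~: (x |: S)| <= k.
  move=> xS; move: Sk; rewrite (cardsD1 x) inE xS add1n ltnS; congr (_ <= k).
  by apply: eq_card => y; rewrite !inE negb_or.
have [|] := pselect (forall e, (src e \in S) = (tgt e \in S)).
  by exists S, T.
move=> /existsNP[e]; case se: (src e \in S); case te: (tgt e \in S) => // _.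
  by apply: (IH _ _ (tree_tgt tr se (negbT te))); rewrite grow ?te.
by apply: (IH _ _ (tree_src tr te (negbT se))); rewrite grow ?se.
Qed.

End SpanningTree.

(** * The a-orbits and b-orbits of a folded graph *)

Section Orbits.
Variables (V : finType) (ea eb : rel V).
Hypothesis fd : folded ea eb.

Definition orbit_a (x : V) : {set V} := [set y | (y == x) || ea x y].
Definition orbit_b (x : V) : {set V} := [set y | [|| y == x, eb x y | eb y x]].

Lemma orbit_a_refl x : x \in orbit_a x. Proof. by rewrite inE eqxx. Qed.
Lemma orbit_b_refl x : x \in orbit_b x. Proof. by rewrite inE eqxx. Qed.

Lemma eb_path2 x y z : eb x y -> eb y z -> eb z x. Proof. exact: (eb_triangle fd). Qed.

Lemma orbit_a_eq x y : (orbit_a x == orbit_a y) = (y \in orbit_a x).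
Proof.
apply/eqP/idP => [->|]; first exact: orbit_a_refl.
rewrite inE => /orP[/eqP->//|exy]; have eyx := ea_sym fd exy.
apply/finset.setP => z; rewrite !inE; apply/orP/orP => -[/eqP->|e]; [by right| |by right|].
  by left; rewrite (ea_fun fd exy e).
by left; rewrite (ea_fun fd eyx e).
Qed.

Lemma orbit_b_sym x y : (y \in orbit_b x) = (x \in orbit_b y).
Proof. by rewrite !inE eq_sym [eb x y || _]orbC. Qed.

Lemma orbit_b_trans x y z : y \in orbit_b x -> z \in orbit_b y -> z \in orbit_b x.
Proof.
rewrite !inE => /or3P[/eqP->//|xy|yx] /or3P[/eqP->|yz|zy]; rewrite ?xy ?yx ?orbT //.
- by rewrite (eb_path2 xy yz) !orbT.
- by rewrite (eb_inj fd xy zy) eqxx.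
- by rewrite (eb_fun fd yx yz) eqxx.
- by rewrite (eb_path2 zy yx) !orbT.
Qed.

Lemma orbit_b_eq x y : (orbit_b x == orbit_b y) = (y \in orbit_b x).
Proof.
apply/eqP/idP => [->|xy]; first exact: orbit_b_refl.
apply/finset.setP => z; apply/idP/idP; apply: orbit_b_trans => //.
by rewrite orbit_b_sym.
Qed.

End Orbits.

Section Kurosh.
Variables (V : finType) (ea eb : rel V) (v0 : V).
Hypothesis rg : rooted_graph ea eb v0.

Let fd := rooted_folded rg.

(** Nodes of the bipartite graph in which the edge x joins the a-orbit and the b-orbit of x. The sum
    type keeps apart orbits of the two kinds that coincide as sets. *)
Definition node_a (x : V) : {set V} + {set V} := inl (orbit_a ea x).
Definition node_b (x : V) : {set V} + {set V} := inr (orbit_b eb x).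

(** Reading a letter stays within one orbit, so connectedness carries over to the bipartite graph
    and the tree reaches every node. *)
Lemma orbit_tree : exists T : {set V},
  tree node_a node_b v0 (node_a @: V :|: node_b @: V) T /\
  #|T|.+1 = (#|orbit_a ea @: V| + #|orbit_b eb @: V|)%N.
Proof.
have [S [T [tr Scl]]] := spanning_tree node_a node_b v0.
have Sx x : node_a x \in S.
  have [w] := rooted_reads rg x; elim/last_ind: w x => [|w l IH] x.
    by move=> <-; apply: tree_root_mem tr.
  case/reads_rcons => y /IH Sy lyx; case: l lyx => /= lyx.
  - suff <- : node_a y = node_a x by [].
    by congr inl; apply/eqP; rewrite (orbit_a_eq fd) inE lyx orbT.
  - rewrite Scl; suff <- : node_b y = node_b x by rewrite -Scl.
    by congr inr; apply/eqP; rewrite (orbit_b_eq fd) inE lyx orbT.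
  - rewrite Scl; suff <- : node_b y = node_b x by rewrite -Scl.
    by congr inr; apply/eqP; rewrite (orbit_b_eq fd) inE lyx !orbT.
have S_eq : S = node_a @: V :|: node_b @: V.
  apply/eqP; rewrite finset.eqEsubset (tree_sub tr) /= finset.subUset.
  by apply/andP; split; apply/fintype.subsetP => _ /imsetP[x _ ->]; rewrite -?Scl Sx.
exists T; split; first by rewrite -S_eq.
rewrite -(tree_card tr) S_eq cardsU.
have -> : node_a @: V :&: node_b @: V = finset.set0.
  apply/finset.setP => n; rewrite !inE; apply/negP => /andP[/imsetP[x _ ->] /imsetP[y _]].
  by [].
rewrite cards0 subn0; congr (_ + _)%N.
- by rewrite -(card_imset _ (@inl_inj {set V} {set V})) -imset_comp.
- by rewrite -(card_imset _ (@inr_inj {set V} {set V})) -imset_comp.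
Qed.

(** * The covering graph and potentials along the tree *)

Section Covering.
Variables (F : groupType) (t s z : V -> F).
Hypothesis t_cycle : forall x y, ea x y -> t x * t y = 1.
Hypothesis t_noloop : forall x y, ea x y -> x != y -> t x = 1.
Hypothesis s_cycle : forall x y z, eb x y -> eb y z -> s x * s y * s z = 1.
Hypothesis s_noloop : forall x y, eb x y -> x != y -> s x = 1.

(** The second coordinate, the height, records an element of the free product. The factor [t x] is
    picked up at an a-loop and [s x] at a b-loop, while [z x] is the cost of passing at x from its
    a-orbit to its b-orbit; a b-edge passes over at its source and back at its target. *)
Definition cover_a (p q : V * F) : Prop := ea p.1 q.1 /\ q.2 = p.2 * t p.1.
Definition cover_b (p q : V * F) : Prop :=
  eb p.1 q.1 /\ q.2 = p.2 * (z p.1 * s p.1 * (z q.1)^-1).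

(** The factors [z] telescope along consecutive b-edges, so triangles close by [s_cycle]; [t_cycle]
    makes the lifted a-edges symmetric. *)
Lemma cover_folded : folded cover_a cover_b.
Proof.
split=> [[x f] [y g]|[x f] [y g] [y' g']|[x f] [y g] [y' g']|[x f] [x' f'] [y g]
        |[x f] [y g] [w h]]; rewrite /cover_a /cover_b /=.
- move=> [xy ->]; split; first exact: (ea_sym fd).
  by rewrite -mulgA t_cycle // mulg1.
- by move=> [xy ->] [xy' ->]; rewrite (ea_fun fd xy xy').
- by move=> [xy ->] [xy' ->]; rewrite (eb_fun fd xy xy').
- by move=> [xy ->] [x'y]; rewrite (eb_inj fd xy x'y) => /mulIg->.
- move=> [xy ->] [yw ->]; have wx := eb_path2 fd xy yw; split=> //.
  rewrite -!mulgA !mulKg; rewrite -[LHS]mulg1; congr (_ * _).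
  by rewrite !mulgA -(mulgA (z x)) -(mulgA (z x)) s_cycle // mulg1 mulgV.
Qed.

(** Edges multiply the height on the right, so left multiplication by [F] acts by deck
    transformations. *)
Lemma ledge_cover_shift l x y f g h :
  ledge cover_a cover_b l (x, f) (y, g) -> ledge cover_a cover_b l (x, h * f) (y, h * g).
Proof.
by case: l; rewrite /= /cover_a /cover_b /= => -[e ->]; split; rewrite // mulgA.
Qed.

Lemma reads_cover_shift w x y f g h :
  reads cover_a cover_b w (x, f) (y, g) -> reads cover_a cover_b w (x, h * f) (y, h * g).
Proof.
elim: w x f => [|l w IH] x f /=; first by case=> -> ->.
by move=> [[x' f'] lxx' /IH wy]; exists (x', h * f') => //; apply: ledge_cover_shift.
Qed.

(** [PA x] and [PB x] are labels of paths from the root to x whose lifts end at height 1 on the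
    a-side and at height (z x)^-1 on the b-side. Inside an orbit they change by the letter of the
    edge, and at a tree edge they agree. *)
Definition potential_spec (S : {set {set V} + {set V}}) (T : {set V})
    (PA PB : V -> PSL2Z) : Prop :=
  [/\ forall x, node_a x \in S ->
        exists2 w, reads cover_a cover_b w (v0, 1) (x, 1) & word_val w = PA x,
      forall x, node_b x \in S ->
        exists2 w, reads cover_a cover_b w (v0, 1) (x, (z x)^-1) & word_val w = PB x,
      forall x y, ea x y -> x != y -> node_a x \in S -> PA y = PA x * gen_a,
      forall x y, eb x y -> x != y -> node_b x \in S -> PB y = PB x * gen_b &
      PA v0 = 1 /\ forall x, x \in T -> PA x = PB x].

Lemma node_a_eq x y : (node_a x == node_a y) = (y \in orbit_a ea x).
Proof. by rewrite -(orbit_a_eq fd); apply/eqP/eqP => [[]|e] //; rewrite /node_a e. Qed.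

Lemma node_b_eq x y : (node_b x == node_b y) = (y \in orbit_b eb x).
Proof. by rewrite -(orbit_b_eq fd); apply/eqP/eqP => [[]|e] //; rewrite /node_b e. Qed.

Lemma node_ab x y : (node_a x == node_b y) = false. Proof. by []. Qed.
Lemma node_ba x y : (node_b x == node_a y) = false. Proof. by []. Qed.

Lemma potential_root : exists PA PB, potential_spec [set node_a v0] finset.set0 PA PB.
Proof.
exists (fun x => if x == v0 then 1 else gen_a), (fun=> 1); split.
- move=> x; rewrite inE eq_sym node_a_eq inE.
  have [-> _|xv /= vx] := eqVneq x v0.
    by exists [::] => //; apply: word_val_nil.
  exists [:: La]; last by rewrite /word_val big_seq1.
  exists (x, 1) => //; split=> //=.
  by rewrite (t_noloop vx) ?mulg1 // eq_sym.
- by move=> x; rewrite inE.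
- move=> x y xy nxy; rewrite inE eq_sym node_a_eq inE.
  have [xv _|xv /= vx] := eqVneq x v0.
    by rewrite -xv eq_sym (negPf nxy) mul1g.
  by rewrite (ea_fun fd (ea_sym fd vx) xy) in xv nxy *; rewrite eqxx gen_a2.
- by move=> x y _ _; rewrite inE.
- by rewrite eqxx; split=> // x; rewrite inE.
Qed.

Lemma potential_grow_b S T e PA PB :
  tree node_a node_b v0 S T -> node_a e \in S -> node_b e \notin S -> z e = 1 ->
  potential_spec S T PA PB ->
  exists PB', potential_spec (node_b e |: S) (e |: T) PA PB'.
Proof.
move=> tr ae be ze [IA IB JA JB [P1 PT]].
(* The new b-orbit is entered through e by the path of [PA e]; its other members are the b-successor
   and the b-predecessor of e. *)
exists (fun x => if node_b x == node_b e then
    PA e * (if x == e then 1 else if eb e x then gen_b else gen_b^-1) else PB x).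
have oldb x : node_b x \in S -> (node_b x == node_b e) = false.
  by move=> xS; apply/eqP => xe; rewrite -xe xS in be.
have [w we wPA] := IA e ae.
split.
- by move=> x; rewrite !inE node_ab; apply: IA.
- move=> x; rewrite !inE; case: eqP => [xe _|_ /= xS]; last exact: IB.
  have [->|xne] := eqVneq x e.
    by exists w; rewrite ?ze ?invg1 ?mulg1.
  have : x \in orbit_b eb e by rewrite -node_b_eq xe eqxx.
  rewrite inE (negPf xne) /=; case: (boolP (eb e x)) => [ex _|_ /= xe'].
    exists (rcons w Lb); last by rewrite word_val_rcons wPA.
    apply/reads_rcons; exists (e, 1) => //; split=> //=.
    by rewrite ze (s_noloop ex) ?mul1g // eq_sym.
  exists (rcons w LbV); last by rewrite word_val_rcons wPA.
  apply/reads_rcons; exists (e, 1) => //; split=> //=.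
  by rewrite ze (s_noloop xe') // invg1 !mulg1 mulVg.
- by move=> x y xy nxy; rewrite !inE node_ab; apply: JA.
- move=> x y xy nxy; rewrite !inE.
  have yx : node_b y = node_b x by apply/eqP; rewrite node_b_eq inE xy !orbT.
  rewrite yx; case: eqP => [xe _|_ /= xS]; last exact: JB.
  rewrite -mulgA; congr (_ * _).
  have : x \in orbit_b eb e by rewrite -node_b_eq xe eqxx.
  rewrite inE; have [xe'|xne] /= := eqVneq x e.
    by rewrite -xe' eq_sym (negPf nxy) xy mul1g.
  case: (boolP (eb e x)) => [ex _|nex /= xe'].
    (* Here e, x, y are consecutive on a triangle, so y precedes e and its factor b^-1 is b b. *)
    have ye := eb_path2 fd ex xy; rewrite gen_bb.
    have [yeq|yne] := eqVneq y e.
      by rewrite yeq in ye; rewrite (eb_fun fd ye ex) eqxx in xne.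
    case: (boolP (eb e y)) => // ey.
    by rewrite (eb_inj fd xy ey) eqxx in xne.
  by rewrite (eb_fun fd xy xe') eqxx mulVg.
- split=> // x; rewrite !inE; have [->|_ /= xT] := eqVneq x e.
    by rewrite !eqxx mulg1.
  have /andP[_ xS] := tree_ends tr xT.
  by rewrite (oldb _ xS) PT.
Qed.

Lemma potential_grow_a S T e PA PB :
  tree node_a node_b v0 S T -> node_b e \in S -> node_a e \notin S -> z e = 1 ->
  potential_spec S T PA PB ->
  exists PA', potential_spec (node_a e |: S) (e |: T) PA' PB.
Proof.
move=> tr be ae ze [IA IB JA JB [P1 PT]].
exists (fun x => if node_a x == node_a e then
    PB e * (if x == e then 1 else gen_a) else PA x).
have olda x : node_a x \in S -> (node_a x == node_a e) = false.
  by move=> xS; apply/eqP => xe; rewrite -xe xS in ae.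
have [w we wPB] := IB e be; rewrite ze invg1 in we.
split.
- move=> x; rewrite !inE; case: eqP => [xe _|_ /= xS]; last exact: IA.
  have [->|xne] := eqVneq x e.
    by exists w; rewrite ?mulg1.
  have : x \in orbit_a ea e by rewrite -node_a_eq xe eqxx.
  rewrite inE (negPf xne) /= => ex.
  exists (rcons w La); last by rewrite word_val_rcons wPB.
  apply/reads_rcons; exists (e, 1) => //; split=> //=.
  by rewrite (t_noloop ex) ?mulg1 // eq_sym.
- by move=> x; rewrite !inE node_ba; apply: IB.
- move=> x y xy nxy; rewrite !inE.
  have yx : node_a y = node_a x by apply/eqP; rewrite eq_sym node_a_eq inE xy !orbT.
  rewrite yx; case: eqP => [xe _|_ /= xS]; last exact: JA.
  rewrite -mulgA; congr (_ * _).
  have : x \in orbit_a ea e by rewrite -node_a_eq xe eqxx.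
  rewrite inE; have [xe'|xne] /= := eqVneq x e.
    by rewrite -xe' eq_sym (negPf nxy) mul1g.
  by move=> ex; rewrite (ea_fun fd xy (ea_sym fd ex)) eqxx gen_a2.
- by move=> x y xy nxy; rewrite !inE node_ba; apply: JB.
- split; first by rewrite (olda _ (tree_root_mem tr)).
  move=> x; rewrite !inE; have [->|_ /= xT] := eqVneq x e.
    by rewrite !eqxx mulg1.
  have /andP[xS _] := tree_ends tr xT.
  by rewrite (olda _ xS) PT.
Qed.

Lemma potential_exists S T :
  tree node_a node_b v0 S T -> (forall x, x \in T -> z x = 1) ->
  exists PA PB, potential_spec S T PA PB.
Proof.
elim=> {S T} [|S T e tr IH ae be|S T e tr IH be ae] zT; first exact: potential_root.
- have [|PA [PB PAB]] := IH; first by move=> x xT; apply: zT; rewrite inE xT orbT.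
  have ze : z e = 1 by apply: zT; rewrite !inE eqxx.
  have [PB' H] := potential_grow_b tr ae be ze PAB.
  by exists PA, PB'.
- have [|PA [PB PAB]] := IH; first by move=> x xT; apply: zT; rewrite inE xT orbT.
  have ze : z e = 1 by apply: zT; rewrite !inE eqxx.
  have [PA' H] := potential_grow_a tr be ae ze PAB.
  by exists PA', PB.
Qed.

End Covering.

Section Mark.
Variables (T : finType) (A : {set T}) (K : groupType) (g : 'I_#|A| -> K).

Definition mark (x : T) : K :=
  if [pick i : 'I_#|A| | enum_val i == x] is Some i then g i else 1.

Lemma mark_enum i : mark (enum_val i) = g i.
Proof.
rewrite /mark; case: pickP => [j /eqP/enum_val_inj->//|/(_ i)].
by rewrite eqxx.
Qed.

Lemma mark_out x : x \notin A -> mark x = 1.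
Proof.
move=> xA; rewrite /mark; case: pickP => // i /eqP ix.
by rewrite -ix enum_valP in xA.
Qed.

Lemma mark_in x : x \in A -> exists i : 'I_#|A|, x = enum_val i.
Proof. by move=> xA; exists (enum_rank_in xA x); rewrite enum_rankK_in. Qed.

End Mark.

Definition loops_a : {set V} := [set x | ea x x].
Definition loops_b : {set V} := [set x | eb x x].

(** * The loop group as a free product *)

Section FreeProduct.
Variable T : {set V}.
Hypothesis trT : tree node_a node_b v0 (node_a @: V :|: node_b @: V) T.

Let R := @free_product_rel #|loops_a| #|loops_b| #|~: T|.
Let F : groupType := free_product #|loops_a| #|loops_b| #|~: T|.
Let gen x : F := of_word R [:: (x, false)].
Let t : V -> F := mark (fun i : 'I_#|loops_a| => gen (inl (inl i))).
Let s : V -> F := mark (fun i : 'I_#|loops_b| => gen (inl (inr i))).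
Let z : V -> F := mark (fun i : 'I_#|~: T| => gen (inr i)).

Lemma mark_t2 x : t x * t x = 1.
Proof.
have [/mark_in[i ->]|xA] := boolP (x \in loops_a); last by rewrite /t mark_out // mulg1.
rewrite /t mark_enum /gen -of_wordM; apply: of_word_rel.
by left; exists i.
Qed.

Lemma mark_s3 x : s x * s x * s x = 1.
Proof.
have [/mark_in[i ->]|xA] := boolP (x \in loops_b); last by rewrite /s mark_out // !mulg1.
rewrite /s mark_enum /gen -(of_word_rel (R := R) (r := nseq 3 (inl (inr i), false))).
  by rewrite -mulgA -[nseq _ _]/([:: _] ++ [:: _] ++ [:: _]) !of_wordM.
by right; exists i.
Qed.

Lemma mark_t_noloop x y : ea x y -> x != y -> t x = 1.
Proof.
move=> xy nxy; rewrite /t mark_out // inE; apply/negP => xx.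
by rewrite (ea_fun fd xx xy) eqxx in nxy.
Qed.

Lemma mark_s_noloop x y : eb x y -> x != y -> s x = 1.
Proof.
move=> xy nxy; rewrite /s mark_out // inE; apply/negP => xx.
by rewrite (eb_fun fd xx xy) eqxx in nxy.
Qed.

Lemma mark_t_cycle x y : ea x y -> t x * t y = 1.
Proof.
move=> xy; have [->|nxy] := eqVneq x y; first exact: mark_t2.
rewrite (mark_t_noloop xy nxy) (mark_t_noloop (ea_sym fd xy)) ?mulg1 //.
by rewrite eq_sym.
Qed.

(** Either the three vertices coincide and [mark_s3] applies, or none of them carries a loop and
    every factor is 1. *)
Lemma mark_s_cycle x y w : eb x y -> eb y w -> s x * s y * s w = 1.
Proof.
move=> xy yw; have wx := eb_path2 fd xy yw.
have [e|nxy] := eqVneq x y.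
  have ew : w = y by rewrite -e in yw xy *; apply: (eb_fun fd yw xy).
  by rewrite e ew mark_s3.
have nyw : y != w.
  by apply: contra_neq nxy => e; rewrite -e in yw wx; apply: (eb_fun fd wx yw).
have nwx : w != x.
  by apply: contra_neq nxy => e; rewrite e in wx; apply: (eb_fun fd wx xy).
by rewrite (mark_s_noloop xy nxy) (mark_s_noloop yw nyw) (mark_s_noloop wx nwx) !mulg1.
Qed.

(** Torsion generators go to conjugates of a and b by tree paths, and a free generator to the loop
    out through the a-side of its vertex and back through the b-side. Every path lifts, and its
    label is read off from the height reached ([phi_reads]), which gives surjectivity. Conversely
    each g is the final height of a lifted loop with label [phi g] ([phi_loop]), and in the folded
    cover the end of a path depends only on its label, which gives injectivity. *)
Lemma loop_group_type : has_iso_type #|loops_a| #|loops_b| #|~: T| (loop_group ea eb v0) /\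
  finitely_generated (loop_group ea eb v0).
Proof.
have zT x : x \in T -> z x = 1 by move=> xT; rewrite /z mark_out // inE xT.
have [PA [PB [IA IB JA JB [P1 PT]]]] :=
  potential_exists mark_t_noloop mark_s_noloop trT zT.
have {}IA x := IA x (ltac:(by rewrite inE imset_f)).
have {}IB x := IB x (ltac:(by rewrite inE imset_f ?orbT)).
have {}JA x y xy nxy := JA x y xy nxy (ltac:(by rewrite inE imset_f)).
have {}JB x y xy nxy := JB x y xy nxy (ltac:(by rewrite inE imset_f ?orbT)).
have cf := cover_folded z mark_t_cycle mark_s_cycle.
pose f (x : 'I_#|loops_a| + 'I_#|loops_b| + 'I_#|~: T|) : PSL2Z :=
  match x with
  | inl (inl i) => PA (enum_val i) * gen_a * (PA (enum_val i))^-1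
  | inl (inr i) => PB (enum_val i) * gen_b * (PB (enum_val i))^-1
  | inr i => PA (enum_val i) * (PB (enum_val i))^-1
  end.
have fR r : R r -> word_image f r = 1.
  rewrite /word_image; case=> [] [i ->]; rewrite !big_cons big_nil mulg1 /gen_value /=.
    by rewrite -!mulgA mulKg (mulgA gen_a) gen_a2 mul1g mulgV.
  by rewrite -!mulgA !mulKg (mulgA gen_b) (mulgA _ gen_b) gen_b3 mul1g mulgV.
pose phi : F -> PSL2Z := pres_lift f.
have phiM x y : phi (x * y) = phi x * phi y by apply: pres_liftM.
have phi_gen x : phi (gen x) = f x by apply: pres_lift_gen.
have phi1 : phi 1 = 1 := mulgM1 phiM.
have phi_t x : ea x x -> phi (t x) = PA x * gen_a * (PA x)^-1.
  move=> xx; have /mark_in[i ->] : x \in loops_a by rewrite inE.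
  by rewrite /t mark_enum phi_gen.
have phi_s x : eb x x -> phi (s x) = PB x * gen_b * (PB x)^-1.
  move=> xx; have /mark_in[i ->] : x \in loops_b by rewrite inE.
  by rewrite /s mark_enum phi_gen.
have phi_z x : phi (z x) = PA x * (PB x)^-1.
  have [xT|] := boolP (x \in T); first by rewrite zT // phi1 PT // mulgV.
  by rewrite -finset.in_setC => /mark_in[i ->]; rewrite /z mark_enum phi_gen.
(* The increment of [phi] along a lifted edge is its letter framed by potentials, so increments
   telescope along a path. For a b-edge the factors [z] convert [PA] into [PB], to which [JB]
   applies. *)
have phi_edge l x y g h : ledge (cover_a t) (cover_b s z) l (x, g) (y, h) ->
    (phi g)^-1 * phi h = PA x * letter_val l * (PA y)^-1.
  have phi_b x' y' g' h' : cover_b s z (x', g') (y', h') ->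
      (phi g')^-1 * phi h' = PA x' * gen_b * (PA y')^-1.
    move=> [/= xy ->]; rewrite !phiM mulKg (mulgMV phiM) !phi_z invgM invgK.
    have [e|nxy] := eqVneq x' y'.
      by rewrite -e in xy *; rewrite phi_s // !mulgA !mulgVK.
    by rewrite (mark_s_noloop xy nxy) phi1 mulg1 (JB _ _ xy nxy) !mulgA mulgVK.
  case: l => /=; [|exact: phi_b|].
    move=> [/= xy ->]; rewrite phiM mulKg.
    have [e|nxy] := eqVneq x y; first by rewrite -e in xy *; apply: phi_t.
    by rewrite (mark_t_noloop xy nxy) phi1 (JA _ _ xy nxy) mulgV.
  move/phi_b => e; have := congr1 (fun u => u^-1) e.
  by rewrite !invgM !invgK mulgA.
have phi_reads w x y g : reads ea eb w x y -> exists h,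
    (phi g)^-1 * phi h = PA x * word_val w * (PA y)^-1.
  elim: w x g => [|l w IH] x g /=.
    by move=> ->; exists g; rewrite word_val_nil mulg1 mulVg mulgV.
  move=> [x' lxx' wy].
  have [g' e] : exists g', ledge (cover_a t) (cover_b s z) l (x, g) (x', g').
    case: l lxx' => /= xx'; [by exists (g * t x)|by exists (g * (z x * s x * (z x')^-1))|].
    by exists (g * (z x' * s x' * (z x)^-1)^-1); rewrite /cover_b /= mulgVK.
  have [h hE] := IH _ g' wy; exists h.
  have := congr2 (fun u v => u * v) (phi_edge _ _ _ _ _ e) hE.
  by rewrite word_val_cons /= !mulgA mulgK mulgVK.
have phi_loop g : exists2 w, reads (cover_a t) (cover_b s z) w (v0, 1) (v0, g) &
    word_val w = phi g.
  (* A deck transformation moves the start of a lifted path from height 1 to height [g']. *)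
  have trans w x h k g' : reads (cover_a t) (cover_b s z) w (v0, 1) (x, h) ->
      g' * h = k -> reads (cover_a t) (cover_b s z) w (v0, g') (x, k).
    by move=> r <-; have := reads_cover_shift g' r; rewrite mulg1.
  elim/pres_ind: g => [|g h [u ru eu] [v rv ev]|g [u ru eu]|].
  - by exists [::] => //; rewrite phi1 word_val_nil.
  - exists (u ++ v); last by rewrite word_val_cat eu ev phiM.
    by apply/reads_cat; exists (v0, g) => //; apply: trans rv _.
  - exists (lword_inv u); last by rewrite word_val_inv eu (mulgMV phiM).
    apply: (reads_inv cf); apply: trans ru _; exact: mulVg.
  - case=> [[i|i]|i]; rewrite -/(gen _) phi_gen /=; set x := enum_val i.
    + have xx : ea x x by have := enum_valP i; rewrite inE.
      have [w rw ew] := IA x; exists (w ++ La :: lword_inv w).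
        apply/reads_cat; exists (x, 1) => //.
        exists (x, t x); first by split=> //=; rewrite mul1g.
        apply: (reads_inv cf); apply: trans rw _.
        by rewrite mulg1 /t mark_enum.
      by rewrite word_val_cat word_val_cons word_val_inv ew mulgA.
    + have xx : eb x x by have := enum_valP i; rewrite inE.
      have [w rw ew] := IB x; exists (w ++ Lb :: lword_inv w).
        apply/reads_cat; exists (x, (z x)^-1) => //.
        exists (x, s x * (z x)^-1); first by split=> //=; rewrite !mulgA mulVg mul1g.
        apply: (reads_inv cf); apply: trans rw _.
        by rewrite /s mark_enum.
      by rewrite word_val_cat word_val_cons word_val_inv ew mulgA.
    + have [w rw ew] := IA x; have [w' rw' ew'] := IB x.
      exists (w ++ lword_inv w'); last by rewrite word_val_cat word_val_inv ew ew'.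
      apply/reads_cat; exists (x, 1) => //.
      apply: (reads_inv cf); apply: trans rw' _.
      by rewrite /z mark_enum mulgV.
have phi_in g : loop_group ea eb v0 (phi g).
  have [w rw <-] := phi_loop g; exists w => //.
  suff proj w' p q : reads (cover_a t) (cover_b s z) w' p q -> reads ea eb w' p.1 q.1.
    exact: proj rw.
  elim: w' p => [|l w' IH] p /=; first by move->.
  move=> [p' lpp' /IH r]; exists p'.1 => //.
  by case: l lpp' => /= -[].
have phi_onto h : loop_group ea eb v0 h -> exists g, phi g = h.
  move=> [w rw <-]; have [g] := phi_reads w v0 v0 1 rw.
  by rewrite phi1 P1 invg1 mul1g mulg1 mul1g => <-; exists g.
split.
  exists phi; split=> //.
    move=> g h egh; have [u ru eu] := phi_loop g; have [v rv ev] := phi_loop h.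
    have euv : word_val u = word_val v by rewrite eu ev.
    by case: (reads_val_fun cf euv ru rv).
  apply/seteqP; split=> [_ [g _ <-]|h /phi_onto[g <-]]; [exact: phi_in|by exists g].
exists [seq f x | x : 'I_#|loops_a| + 'I_#|loops_b| + 'I_#|~: T|]; split.
  by move=> _ /fintype.imageP[x _ ->]; have := phi_in (gen x); rewrite phi_gen.
move=> K [K1 KV] Kf h /phi_onto[g <-].
have Kinv k : K k -> K k^-1 by move=> Kk; rewrite -[k^-1]mul1g; apply: KV.
elim/pres_ind: g => [|g g' Kg Kg'|g Kg|x].
- by rewrite phi1.
- by rewrite phiM -[phi g']invgK; apply: KV => //; apply: Kinv.
- by rewrite (mulgMV phiM); apply: Kinv.
- by rewrite -/(gen _) phi_gen; apply/Kf/fintype.imageP; exists x.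
Qed.

End FreeProduct.

Lemma loop_group_iso_type : exists r,
  [/\ has_iso_type #|loops_a| #|loops_b| r (loop_group ea eb v0),
      finitely_generated (loop_group ea eb v0) &
      (r + #|orbit_a ea @: V| + #|orbit_b eb @: V| = #|V|.+1)%N].
Proof.
have [T [tr cT]] := orbit_tree; have [ty fg] := loop_group_type tr.
exists #|~: T|; split=> //.
by rewrite -addnA -cT addnS addnC cardsC.
Qed.

End Kurosh.

(** * Uniqueness of the isomorphism type *)

Section CountHoms.
Variable A : finGroupType.

(** By the universal property, the functions in the family of these predicates correspond to the
    homomorphisms from the free product to [A]. *)
Definition allowed (r2 r3 r : nat) (x : 'I_r2 + 'I_r3 + 'I_r) : pred A :=
  match x with
  | inl (inl _) => [pred u | u * u == 1]
  | inl (inr _) => [pred u | u * u * u == 1]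
  | inr _ => predT
  end.

Lemma card_allowed r2 r3 r : #|(family (@allowed r2 r3 r) : simpl_pred {ffun _ -> A})| =
  (#|[pred u : A | (u * u == 1)%g]| ^ r2 * #|[pred u : A | (u * u * u == 1)%g]| ^ r3 * #|A| ^ r)%N.
Proof.
rewrite card_family foldrE big_image /= big_sumType big_sumType /=.
by rewrite !big_const_ord !iter_muln_1.
Qed.

Lemma allowed_lift r2 r3 r (c : {ffun 'I_r2 + 'I_r3 + 'I_r -> A}) : c \in family (@allowed r2 r3 r) ->
  forall w, @free_product_rel r2 r3 r w -> word_image c w = 1.
Proof.
move=> /familyP fc w [] [i ->]; rewrite /word_image !big_cons big_nil mulg1 /gen_value /=.
- by have := fc (inl (inl i)); rewrite inE => /eqP.
- by have := fc (inl (inr i)); rewrite inE mulgA => /eqP.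
Qed.

(** Homomorphisms are pulled back along [theta]; as [theta] is onto, the pullback determines the
    original. *)
Lemma leq_card_allowed r2 r3 r r2' r3' r'
    (theta : free_product r2 r3 r -> free_product r2' r3' r') :
  (forall x y, theta (x * y) = theta x * theta y) -> (forall y, exists x, theta x = y) ->
  (#|(family (@allowed r2' r3' r') : simpl_pred {ffun _ -> A})| <=
   #|(family (@allowed r2 r3 r) : simpl_pred {ffun _ -> A})|)%N.
Proof.
move=> thetaM theta_surj.
pose gen x : free_product r2 r3 r := of_word _ [:: (x, false)].
pose pull (c : {ffun 'I_r2' + 'I_r3' + 'I_r' -> A}) : {ffun 'I_r2 + 'I_r3 + 'I_r -> A} :=
  [ffun x => pres_lift c (theta (gen x))].
have pullM c : c \in family (@allowed r2' r3' r') ->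
    forall x y, pres_lift c (theta (x * y)) = pres_lift c (theta x) * pres_lift c (theta y).
  by move=> /allowed_lift fc x y; rewrite thetaM pres_liftM.
have pull1 c : c \in family (@allowed r2' r3' r') -> pres_lift c (theta 1) = 1.
  by move=> fc; apply: (mulgM1 (f := fun x => pres_lift c (theta x))); apply: pullM.
rewrite -(card_in_imset (f := pull)).
  apply/subset_leq_card/fintype.subsetP => _ /imsetP[c fc ->]; apply/familyP => x.
  rewrite ffunE; case: x => [[i|i]|i] //; rewrite inE -!pullM //.
  - suff -> : gen (inl (inl i)) * gen (inl (inl i)) = 1 by rewrite pull1.
    by rewrite /gen -of_wordM; apply: of_word_rel; left; exists i.
  - suff -> : gen (inl (inr i)) * gen (inl (inr i)) * gen (inl (inr i)) = 1 by rewrite pull1.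
    rewrite -(@of_word_rel _ (@free_product_rel r2 r3 r) (nseq 3 (inl (inr i), false))).
      by rewrite -mulgA -[nseq _ _]/([:: _] ++ [:: _] ++ [:: _]) !of_wordM.
    by right; exists i.
move=> c d fc fd pcd; apply/ffunP => x.
have [g gx] := theta_surj (of_word _ [:: (x, false)]).
rewrite -(pres_lift_gen (allowed_lift fc) x) -(pres_lift_gen (allowed_lift fd) x) -gx.
apply: (pres_hom_ext (f := fun g => pres_lift c (theta g)) (g := fun g => pres_lift d (theta g))).
- exact: pullM.
- exact: pullM.
by move=> y; have /ffunP/(_ y) := pcd; rewrite !ffunE.
Qed.

End CountHoms.

Lemma has_iso_type_card (A : finGroupType) (G : groupType) (H : set G) r2 r3 r r2' r3' r' :
  has_iso_type r2 r3 r H -> has_iso_type r2' r3' r' H ->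
  (#|(family (@allowed A r2' r3' r') : simpl_pred {ffun _ -> A})| <=
   #|(family (@allowed A r2 r3 r) : simpl_pred {ffun _ -> A})|)%N.
Proof.
move=> [f [fM f_inj fH]] [f' [f'M f'_inj f'H]].
have ex_theta x : exists y, f' y = f x.
  have : range f' (f x) by rewrite f'H -fH; exists x.
  by case=> y _; exists y.
have [theta thetaE] := choice ex_theta.
apply: (@leq_card_allowed A _ _ _ _ _ _ theta) => [x y|y].
  by apply: f'_inj; rewrite f'M !thetaE fM.
have : range f (f' y) by rewrite fH -f'H; exists y.
by case=> x _ fx; exists x; apply: f'_inj; rewrite thetaE.
Qed.

Lemma has_iso_type_uniq (G : groupType) (H : set G) r2 r3 r r2' r3' r' :
  has_iso_type r2 r3 r H -> has_iso_type r2' r3' r' H -> [/\ r2 = r2', r3 = r3' & r = r'].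
Proof.
move=> h h'.
have same (A : finGroupType) :
    (#|[pred u : A | (u * u == 1)%g]| ^ r2 * #|[pred u : A | (u * u * u == 1)%g]| ^ r3 * #|A| ^ r =
     #|[pred u : A | (u * u == 1)%g]| ^ r2' * #|[pred u : A | (u * u * u == 1)%g]| ^ r3' * #|A| ^ r')%N.
  by rewrite -!card_allowed; apply/eqP; rewrite eqn_leq (has_iso_type_card A h h') (has_iso_type_card A h' h).
(* Z/2 and Z/3 give r2 + r and r3 + r; in Z/4 only two elements square to the identity, so it gives
   r2 + 2 r and separates r2 from r. *)
have := same 'Z_2; have := same 'Z_3; have := same 'Z_4.
rewrite !card_ord.
have -> : #|[pred u : 'Z_2 | (u * u == 1)%g]| = 2%N.
  by rewrite -sum1_card big_mkcond /= !big_ord_recl big_ord0.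
have -> : #|[pred u : 'Z_2 | (u * u * u == 1)%g]| = 1%N.
  by rewrite -sum1_card big_mkcond /= !big_ord_recl big_ord0.
have -> : #|[pred u : 'Z_3 | (u * u == 1)%g]| = 1%N.
  by rewrite -sum1_card big_mkcond /= !big_ord_recl big_ord0.
have -> : #|[pred u : 'Z_3 | (u * u * u == 1)%g]| = 3%N.
  by rewrite -sum1_card big_mkcond /= !big_ord_recl big_ord0.
have -> : #|[pred u : 'Z_4 | (u * u == 1)%g]| = 2%N.
  by rewrite -sum1_card big_mkcond /= !big_ord_recl big_ord0.
have -> : #|[pred u : 'Z_4 | (u * u * u == 1)%g]| = 1%N.
  by rewrite -sum1_card big_mkcond /= !big_ord_recl big_ord0.
rewrite !exp1n !muln1 !mul1n (_ : (Zp_trunc 4).+2 = 2 ^ 2)%N // -!expnM -!expnD.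
move=> /eqP; rewrite eqn_exp2l // => /eqP e4 /eqP; rewrite eqn_exp2l // => /eqP e3.
move=> /eqP; rewrite eqn_exp2l // => /eqP e2.
by split; lia.
Qed.

(** * From a subgroup to a labeled graph *)

Section StallingsGraph.
Variable H : set PSL2Z.
Hypothesis sgH : subgroup H.

Let S := stallings H.
Let sedge := ledge (aedge S) (bedge S).

Lemma subgroupV g : H g -> H g^-1.
Proof. by case: sgH => H1 HV Hg; rewrite -[g^-1]mul1g; apply: HV. Qed.

Lemma subgroupM g h : H g -> H h -> H (g * h).
Proof. by case: sgH => H1 HV Hg Hh; rewrite -[h]invgK; apply: HV => //; apply: subgroupV. Qed.

Lemma coset_vertex_eq g h : coset_vertex H g = coset_vertex H h <-> H (g * h^-1).
Proof.
case: sgH => H1 HV; split=> [e|gh].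
  have : coset_vertex H h g by rewrite -e; exists 1; rewrite ?mul1g.
  by case=> k Hk <-; rewrite mulgK.
apply/seteqP; split=> _ [k Hk <-].
  by exists (k * (g * h^-1)); [exact: subgroupM|rewrite !mulgA mulgVK].
exists (k * (g * h^-1)^-1); first by apply: subgroupM => //; apply: subgroupV.
by rewrite invgM invgK !mulgA mulgVK.
Qed.

Lemma coset_vertexM g h k :
  coset_vertex H g = coset_vertex H h -> coset_vertex H (g * k) = coset_vertex H (h * k).
Proof. by move=> /coset_vertex_eq e; apply/coset_vertex_eq; rewrite invgM mulgA mulgK. Qed.

Lemma root_vertex_eq g : coset_vertex H g = root_vertex H <-> H g.
Proof. by rewrite coset_vertex_eq invg1 mulg1. Qed.

Lemma traverses_inv u l v : traverses H u l v ->
  [/\ traverses H (lword_inv v) (letter_inv l) (lword_inv u),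
      coset_vertex H (word_val (lword_inv v)) = coset_vertex H (word_val (rcons u l)) &
      coset_vertex H (word_val (rcons (lword_inv v) (letter_inv l))) =
        coset_vertex H (word_val u)].
Proof.
move=> [g Huv]; split.
- rewrite /traverses; have -> : lword_inv v ++ letter_inv l :: lword_inv u = lword_inv (u ++ l :: v).
    by rewrite lword_inv_cat lword_inv_cons cat_rcons.
  by split; rewrite ?geodesic_inv ?word_val_inv //; apply: subgroupV.
- apply/esym/coset_vertex_eq; rewrite word_val_inv invgK -word_val_cat.
  by rewrite cat_rcons.
- apply/esym/coset_vertex_eq; rewrite word_val_rcons word_val_inv letter_val_inv.
  by rewrite -invgM invgK -word_val_cons -word_val_cat.
Qed.

(** An edge may come from a loop crossing it in the opposite direction; by [traverses_inv] the
    inverse loop crosses it in the required one. *)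
Lemma stallings_ledge l x y : sedge l x y <-> exists u v, [/\ traverses H u l v,
  x = coset_vertex H (word_val u) & y = coset_vertex H (word_val (rcons u l))].
Proof.
split; last first.
  move=> [u [v [t -> ->]]]; case: l t => t /=; exists u, v.
  - by split=> //; left.
  - by left.
  - by right.
case: l => /= [[u [v [t [[-> ->]|[-> ->]]]]]|[u [v [[t [-> ->]]|[t [-> ->]]]]]
  |[u [v [[t [-> ->]]|[t [-> ->]]]]]]; try by exists u, v.
all: by have [t' e1 e2] := traverses_inv t; exists (lword_inv v), (lword_inv u).
Qed.

Lemma sedge_coset l x y : sedge l x y -> exists g,
  x = coset_vertex H g /\ y = coset_vertex H (g * letter_val l).
Proof. by move=> /stallings_ledge[u [v [_ -> ->]]]; exists (word_val u); rewrite -word_val_rcons. Qed.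

Lemma sedge_fun l x y z : sedge l x y -> sedge l x z -> y = z.
Proof.
move=> /sedge_coset[g [-> ->]] /sedge_coset[h [e ->]]; exact: coset_vertexM.
Qed.

Lemma stallings_folded : folded (aedge S) (bedge S).
Proof.
split.
- move=> x y [u [v [t [[-> ->]|[-> ->]]]]]; exists u, v; split=> //; first by right.
  by left.
- exact: (@sedge_fun La).
- exact: (@sedge_fun Lb).
- by move=> x y z xz yz; apply: (@sedge_fun LbV _ _ _ xz yz).
- move=> x y z xy yz.
  have /stallings_ledge[u [v [[g Huv] -> ey]]] : sedge Lb x y by [].
  have /stallings_ledge[u' [v' [[g' Huv'] ey' ->]]] : sedge Lb y z by [].
  have {ey ey'} e : coset_vertex H (word_val u * gen_b) = coset_vertex H (word_val u').
    by rewrite -ey' ey word_val_rcons.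
  (* The loops u b v and u' b v' are spliced into u b^-1 v'. Its value is the product of an element
     of H, obtained from [e], and the value of u' b v'; it is geodesic because b^-1 is of the same
     type as b. *)
  suff : sedge LbV (coset_vertex H (word_val u))
    (coset_vertex H (word_val (rcons u' Lb))) by [].
  apply/stallings_ledge; exists u, v'; split=> //.
  + split.
      by move: g g'; rewrite !geodesic_mid /= => /and4P[-> _ -> _] /and4P[_ -> _ ->].
    have := subgroupM ((coset_vertex_eq _ _).1 e) Huv'.
    rewrite word_val_cat !word_val_cons /= mulgA mulgVK word_val_cat word_val_cons /=.
    by rewrite -!mulgA (mulgA gen_b) gen_bb.
  + by rewrite !word_val_rcons /= -(coset_vertexM gen_b e) -mulgA gen_bb.
Qed.

Lemma stallings_prefix u v : geodesic (u ++ v) -> H (word_val (u ++ v)) ->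
  reads (aedge S) (bedge S) u (root_vertex H) (coset_vertex H (word_val u)).
Proof.
elim/last_ind: u v => [|u l IH] v; first by rewrite /= word_val_nil.
rewrite cat_rcons => g Huv; apply/reads_rcons; exists (coset_vertex H (word_val u)).
  exact: IH g Huv.
by apply/stallings_ledge; exists u, v.
Qed.

Lemma reads_stallings w g y : reads (aedge S) (bedge S) w (coset_vertex H g) y ->
  y = coset_vertex H (g * word_val w).
Proof.
elim: w g => [|l w IH] g /=; first by rewrite word_val_nil mulg1 => <-.
move=> [z /sedge_coset[h [/coset_vertexM e ez]]]; rewrite ez -(e (letter_val l)) => /IH->.
by rewrite word_val_cons mulgA.
Qed.

Lemma stallings_sedge_vertex l x y : sedge l x y -> vertex S x /\ vertex S y.
Proof.
move=> /stallings_ledge[u [v [[g Huv] -> ->]]]; split; first by exists u, (l :: v).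
by exists (rcons u l), v; rewrite cat_rcons.
Qed.

(** A vertex other than the root is strictly inside a geodesic loop, hence between two letters of
    opposite types. *)
Lemma stallings_on_edge x : vertex S x -> x <> root_vertex H ->
  on_edge (aedge S) x /\ on_edge (bedge S) x.
Proof.
move=> [u [v [g Huv ->]]].
case/lastP: u g Huv => [|u l]; first by rewrite word_val_nil.
case: v => [|l' v]; first by rewrite cats0 => _ Hu []; apply/root_vertex_eq.
move=> g Huv _.
have e1 : sedge l (coset_vertex H (word_val u)) (coset_vertex H (word_val (rcons u l))).
  by apply/stallings_ledge; exists u, (l' :: v); rewrite /traverses -cat_rcons.
have e2 : sedge l' (coset_vertex H (word_val (rcons u l)))
    (coset_vertex H (word_val (rcons (rcons u l) l'))).
  by apply/stallings_ledge; exists (rcons u l), v.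
have : is_a l != is_a l'.
  by move: g; rewrite geodesic_cat last_rcons /= => /and3P[_ _]; rewrite orbF; case: u {Huv e1 e2}.
by case: l l' e1 e2 {g Huv} => [] [] //= e1 e2 _; split;
  solve [by eexists; left; eauto | by eexists; right; eauto].
Qed.

(** * Transport of the Stallings graph to a set of labels *)

Section Labeling.
Variables (V : finType) (lab : V -> set PSL2Z).
Hypothesis lab_inj : injective lab.
Hypothesis lab_range : range lab = vertex S.

Definition label_a : rel V := fun x y => `[< aedge S (lab x) (lab y) >].
Definition label_b : rel V := fun x y => `[< bedge S (lab x) (lab y) >].

Lemma ledge_label l x y : ledge label_a label_b l x y <-> sedge l (lab x) (lab y).
Proof. by case: l; split=> /asboolP. Qed.

Lemma label_folded : folded label_a label_b.
Proof.
have sf := stallings_folded; split.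
- by move=> x y /asboolP xy; apply/asboolP/(ea_sym sf).
- by move=> x y z /asboolP xy /asboolP xz; apply/lab_inj/(ea_fun sf xy xz).
- by move=> x y z /asboolP xy /asboolP xz; apply/lab_inj/(eb_fun sf xy xz).
- by move=> x y z /asboolP xy /asboolP xz; apply/lab_inj/(eb_inj sf xy xz).
- by move=> x y z /asboolP xy /asboolP xz; apply/asboolP/(eb_triangle sf xy xz).
Qed.

Lemma reads_label w x c : reads (aedge S) (bedge S) w (lab x) c ->
  exists2 y, c = lab y & reads label_a label_b w x y.
Proof.
elim: w x => [|l w IH] x /=; first by move<-; exists x.
move=> [d xd dc]; have [_] := stallings_sedge_vertex xd.
rewrite -lab_range => -[z _ zd]; rewrite -zd in xd dc.
have [y -> zy] := IH z dc; exists y => //; exists z => //.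
exact/ledge_label.
Qed.

Lemma label_reads w x y : reads label_a label_b w x y ->
  reads (aedge S) (bedge S) w (lab x) (lab y).
Proof.
elim: w x => [|l w IH] x /=; first by move=> ->.
by move=> [z /ledge_label xz zy]; exists (lab z) => //; apply: IH.
Qed.

Lemma label_root : exists v0, lab v0 = root_vertex H.
Proof.
have : vertex S (root_vertex H).
  by exists [::], [::]; rewrite /= word_val_nil; split=> //; case: sgH.
by rewrite -lab_range => -[v0 _ <-]; exists v0.
Qed.

Variable v0 : V.
Hypothesis lab_v0 : lab v0 = root_vertex H.

Lemma label_rooted_graph : rooted_graph label_a label_b v0.
Proof.
have on_edge_label (e : set PSL2Z -> set PSL2Z -> Prop) x :
    (forall c d, e c d -> vertex S c /\ vertex S d) -> on_edge e (lab x) ->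
    on_edge (fun x y => `[< e (lab x) (lab y) >]) x.
  move=> eS [c ec]; have : vertex S c by case: ec => /eS[].
  by rewrite -lab_range => -[y _ yc]; exists y; rewrite yc; case: ec => /asboolP; auto.
have vertex_lab x : vertex S (lab x) by rewrite -lab_range; exists x.
split=> [|x|x xv0|x xv0]; first exact: label_folded.
- have [u [v [g Huv xu]]] := vertex_lab x.
  have := stallings_prefix g Huv; rewrite -lab_v0 -xu => /reads_label[y /lab_inj<- r].
  by exists u.
- apply: on_edge_label => [c d|]; first exact: (@stallings_sedge_vertex La).
  apply: proj1 (stallings_on_edge (vertex_lab x) _).
  by rewrite -lab_v0 => /lab_inj.
- apply: on_edge_label => [c d|]; first exact: (@stallings_sedge_vertex Lb).
  apply: proj2 (stallings_on_edge (vertex_lab x) _).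
  by rewrite -lab_v0 => /lab_inj.
Qed.

(** Reading a word multiplies cosets on the right, so a loop at the root has its value in H.
    Conversely the geodesic word of an element of H labels a loop of the Stallings graph by
    construction. *)
Lemma label_loop_group : loop_group label_a label_b v0 = H.
Proof.
apply/seteqP; split=> [_ [w /label_reads r <-]|h Hh].
  move: r; rewrite lab_v0 => /reads_stallings; rewrite mul1g => e.
  exact/root_vertex_eq.
have [w wh] := word_val_surj h; have g := geodesic_reduce w.
have ew : word_val (reduce w) = h by rewrite word_val_reduce.
have Hw : H (word_val (reduce w ++ [::])) by rewrite cats0 ew.
have := stallings_prefix (v := [::]) _ Hw; rewrite cats0 => /(_ g).
have /root_vertex_eq -> : H (word_val (reduce w)) by rewrite ew.
by rewrite -{1}lab_v0 => /reads_label[y]; rewrite -lab_v0 => /lab_inj <- r; exists (reduce w).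
Qed.

Lemma label_path_class : path_class label_a label_b v0 = lab.
Proof.
apply/funext => x; have [w r] := rooted_reads label_rooted_graph x.
rewrite -(coset_path_class label_folded r) label_loop_group.
have := label_reads r; rewrite lab_v0 => /reads_stallings->.
by rewrite mul1g.
Qed.

End Labeling.
End StallingsGraph.

(** * Cyclically reduced graphs *)

Lemma reads_clos (V : Type) (ea eb : V -> V -> Prop) w x y : reads ea eb w x y ->
  clos_refl_sym_trans V (fun u v => ea u v \/ eb u v) x y.
Proof.
elim: w x => [|l w IH] x /=; first by move->; apply: rst_refl.
move=> [z xz /IH zy]; apply: rst_trans zy; case: l xz => /= xz.
- by apply: rst_step; left.
- by apply: rst_step; right.
- by apply/rst_sym/rst_step; right.
Qed.

Lemma clos_reads (V : Type) (ea eb : V -> V -> Prop) x y : folded ea eb ->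
  clos_refl_sym_trans V (fun u v => ea u v \/ eb u v) x y -> exists w, reads ea eb w x y.
Proof.
move=> fd; elim=> {x y} [x y [xy|xy]|x|x y _ [w r]|x y z _ [u ru] _ [v rv]].
- by exists [:: La], y.
- by exists [:: Lb], y.
- by exists [::].
- by exists (lword_inv w); apply: reads_inv.
- by exists (u ++ v); apply/reads_cat; exists y.
Qed.

Section CyclicallyReduced.
Variables (V : Type) (Gm : abgraph V).

Lemma folded_cyclically_reduced x0 : folded (aedge Gm) (bedge Gm) ->
  (forall x y, aedge Gm x y -> vertex Gm x /\ vertex Gm y) ->
  (forall x y, bedge Gm x y -> vertex Gm x /\ vertex Gm y) ->
  finite_set (vertex Gm) -> vertex Gm x0 ->
  (forall x, vertex Gm x -> exists w, reads (aedge Gm) (bedge Gm) w x0 x) ->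
  (forall x, vertex Gm x -> on_edge (aedge Gm) x /\ on_edge (bedge Gm) x) ->
  cyclically_reduced Gm.
Proof.
move=> fd va vb finV vx0 conn on; split=> //.
- by split=> //; apply: (ea_sym fd).
- split; first by exists x0.
  move=> x y /conn[u /(reads_inv fd) ux] /conn[v vy]; apply: (@reads_clos _ _ _ (lword_inv u ++ v)).
  by apply/reads_cat; exists x0.
- move=> x /on[[y xy] _]; have {}xy : aedge Gm x y by case: xy => // /(ea_sym fd).
  by exists y; split=> // z; apply: (ea_fun fd).
split=> [||x /on[]//|x y xy]; [exact: (eb_fun fd)|exact: (eb_inj fd)|].
have [<-|nxy] := pselect (x = y); first by constructor 1.
(* If y has a successor, the path closes to a triangle. If not, x has no predecessor u either, since
   u, x, y would close with an edge from y to u, and the edge is isolated. *)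
have [[z yz]|noz] := pselect (exists z, bedge Gm y z).
  have zx := eb_triangle fd xy yz; constructor 3; exists z; split=> //; split=> // e.
    by rewrite -e in yz; apply: nxy; apply: (eb_inj fd xy yz).
  by rewrite e in zx; apply: nxy; apply: (eb_fun fd zx xy).
constructor 2; split=> // u v uv [e|[e|[e|e]]].
- by rewrite e in uv *; split=> //; apply: (eb_fun fd uv xy).
- by case: noz; exists v; rewrite -e.
- by case: noz; exists u; rewrite e in uv; apply: (eb_triangle fd uv xy).
- by rewrite e in uv *; split=> //; apply: (eb_inj fd uv xy).
Qed.

Lemma cyclically_reduced_on_edge : cyclically_reduced Gm ->
  forall x, vertex Gm x -> on_edge (aedge Gm) x /\ on_edge (bedge Gm) x.
Proof.
move=> [_ _ _ ona [_ _ onb _]] x vx; split; last exact: onb.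
by have [y [xy _]] := ona x vx; exists y; left.
Qed.

Lemma cyclically_reduced_folded : cyclically_reduced Gm -> folded (aedge Gm) (bedge Gm).
Proof.
move=> [[va vb sym] _ _ ona [bf bi onb tri]]; split=> //.
  move=> x y z xy xz; have [vx _] := va _ _ xy.
  by have [t [_ tu]] := ona x vx; rewrite -(tu y xy) -(tu z xz).
move=> x y z xy yz; have [e|[_ nxy iso]|[t [[_ yt tx] _]]] := tri _ _ xy.
- by rewrite e in xy *; rewrite -(bf _ _ _ xy yz).
- by have [|e _] := iso _ _ yz; [right; left|case: nxy].
- by rewrite (bf _ _ _ yz yt).
Qed.

End CyclicallyReduced.

Lemma partition_card_size (T : finType) (P : {set {set T}}) :
  finset.partition P [set: T]%SET -> (forall A, A \in P -> 0 < #|A| <= 3) ->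
  #|P| = (#|[set A in P | #|A| == 1]| + #|[set A in P | #|A| == 2]|
          + #|[set A in P | #|A| == 3]|)%N /\
  #|T| = (#|[set A in P | #|A| == 1]| + 2 * #|[set A in P | #|A| == 2]|
          + 3 * #|[set A in P | #|A| == 3]|)%N.
Proof.
move=> partP sizeP.
have card k : #|[set A in P | #|A| == k]| = (\sum_(A in P) (#|A| == k))%N.
  by rewrite cardsE -sum1_card big_mkcondr.
rewrite !card -cardsT (card_partition partP) -sum1_card !big_distrr -!big_split /=.
by split; apply: eq_bigr => A /sizeP; case: #|A| => [|[|[|[|]]]].
Qed.

(** * Counting orbits by loops, isolated edges and triangles *)

Section OrbitCounts.
Variables (V : finType) (ea eb : rel V).
Hypothesis fd : folded ea eb.

Let fibre_partition (f : V -> {set V}) : (forall x y, (f x == f y) = (y \in f x)) ->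
  finset.partition (f @: V) [set: V]%SET.
Proof.
move=> fE; suff -> : f @: V = preim_partition f [set: V]%SET by apply: preim_partitionP.
apply/finset.setP => A; apply/imsetP/imsetP => -[x _ ->]; exists x; rewrite ?inE //.
  by apply/finset.setP => y; rewrite !inE fE.
by apply/finset.setP => y; rewrite !inE fE.
Qed.

Lemma orbit_a_count : (forall x, on_edge ea x) ->
  let k := #|[set [set p.1; p.2] | p in [set p : V * V | ea p.1 p.2] & p.1 != p.2]| in
  #|V| = (#|loops_a ea| + 2 * k)%N /\ #|orbit_a ea @: V| = (#|loops_a ea| + k)%N.
Proof.
move=> on k.
have orbE x y : ea x y -> orbit_a ea x = [set x; y].
  move=> xy; apply/finset.setP => z; rewrite !inE; case: eqVneq => //= _.
  by apply/idP/eqP => [xz|->//]; apply: (ea_fun fd xz xy).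
have out x : exists y, ea x y by have [y [|/(ea_sym fd)]] := on x; exists y.
have [|cP cV] := partition_card_size (fibre_partition (orbit_a_eq fd)).
  by move=> _ /imsetP[x _ ->]; have [y /orbE->] := out x; rewrite cards2; case: (x != y).
have P3 : [set A in orbit_a ea @: V | #|A| == 3%N] = finset.set0.
  apply/finset.setP => A; rewrite !inE; apply/negP => /andP[/imsetP[x _ ->]].
  by have [y /orbE->] := out x; rewrite cards2; case: (x != y).
have P1 : [set A in orbit_a ea @: V | #|A| == 1%N] = [set [set x] | x in loops_a ea].
  apply/finset.setP => A; rewrite inE; apply/andP/imsetP => [[/imsetP[x _ ->]]|[x]].
    have [y xy] := out x; rewrite (orbE _ _ xy) cards2; case: (eqVneq x y) => // e _.
    by exists x; rewrite ?inE -?e ?finset.setUid // {2}e.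
  rewrite inE => xx ->; rewrite cards1; split=> //; apply/imsetP; exists x => //.
  by rewrite (orbE _ _ xx) finset.setUid.
have P2 : [set A in orbit_a ea @: V | #|A| == 2%N] =
    [set [set p.1; p.2] | p in [set p : V * V | ea p.1 p.2] & p.1 != p.2].
  apply/finset.setP => A; rewrite inE; apply/andP/imsetP => [[/imsetP[x _ ->]]|[[x y]]].
    have [y xy] := out x; rewrite (orbE _ _ xy) cards2; case: (eqVneq x y) => // e _.
    by exists (x, y); rewrite // !inE xy.
  rewrite !inE /= => /andP[xy nxy] ->; rewrite cards2 nxy; split=> //.
  by apply/imsetP; exists x => //; rewrite (orbE _ _ xy).
move: cP cV; rewrite P1 P2 P3 cards0 muln0 !addn0 (card_imset _ (@finset.set1_inj V)).
by move=> -> ->.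
Qed.

(** Orbits of one, two and three elements are the b-loops, the isolated b-edges and the b-triangles;
    [t] counts the triangles. *)
Lemma orbit_b_count (Gm : abgraph V) : (forall x, on_edge eb x) ->
  (forall x y, bedge Gm x y <-> eb x y) ->
  exists t, let k := #|[pred p : V * V | `[< isolated_bedge Gm p.1 p.2 >]]| in
  #|V| = (#|loops_b eb| + 2 * k + 3 * t)%N /\
  #|orbit_b eb @: V| = (#|loops_b eb| + k + t)%N.
Proof.
move=> on GmE; pose I := [set p : V * V | `[< isolated_bedge Gm p.1 p.2 >]].
have rep x : exists2 y, orbit_b eb x = orbit_b eb y & exists z, eb y z.
  have [y [xy|yx]] := on x; first by exists x => //; exists y.
  exists y; last by exists x.
  by apply/eqP; rewrite (orbit_b_eq fd) inE yx !orbT.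
have orb1 x : eb x x -> orbit_b eb x = [set x].
  move=> xx; apply/finset.setP => z; rewrite !inE; case: (eqVneq z x) => //= nzx.
  apply/negP => /orP[xz|zx]; first by rewrite (eb_fun fd xz xx) eqxx in nzx.
  by rewrite (eb_inj fd zx xx) eqxx in nzx.
have orb2 x y : isolated_bedge Gm x y -> orbit_b eb x = [set x; y].
  move=> [/GmE xy nxy iso]; apply/finset.setP => z; rewrite !inE.
  case: (eqVneq z x) => //= nzx; apply/orP/eqP => [[xz|zx]|->]; last by left.
    exact: (eb_fun fd xz xy).
  have [zx' _] := iso z x ((GmE _ _).2 zx) (or_intror (or_intror (or_introl erefl))).
  by rewrite zx' eqxx in nzx.
have orb3 x y z : eb x y -> eb y z -> x <> y -> #|orbit_b eb x| = 3%N.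
  move=> xy yz /eqP nxy; have zx := eb_triangle fd xy yz.
  have nyz : y != z.
    by apply: contra_neq nxy => e; rewrite -e in yz; apply: (eb_inj fd xy yz).
  have nxz : x != z.
    by apply: contra_neq nxy => e; rewrite -e in zx; apply: (eb_fun fd zx xy).
  have -> : orbit_b eb x = z |: [set x; y].
    apply/finset.setP => w; rewrite !inE.
    have -> : eb x w = (w == y).
      by apply/idP/eqP => [xw|->//]; apply: (eb_fun fd xw xy).
    have -> : eb w x = (w == z).
      by apply/idP/eqP => [wx|->//]; apply: (eb_inj fd wx zx).
    by rewrite orbA orbC.
  by rewrite cardsU1 cards2 !inE nxy negb_or eq_sym nxz eq_sym nyz.
have kind A : A \in orbit_b eb @: V -> [\/ exists2 x, eb x x & A = [set x],
    exists2 p, p \in I & A = [set p.1; p.2] | #|A| = 3%N].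
  move=> /imsetP[x _ ->]; have [y -> [z yz]] := rep x.
  have [e|nyz] := eqVneq y z.
    by rewrite -e in yz; constructor 1; exists y => //; apply: orb1.
  have [[w zw]|noz] := pselect (exists w, eb z w).
    by constructor 3; apply: orb3 yz zw _; apply/eqP.
  have iso : isolated_bedge Gm y z.
    split; [exact/GmE|exact/eqP|move=> u v /GmE uv].
    case=> [e|[e|[e|e]]]; rewrite e in uv *.
    - by split=> //; apply: (eb_fun fd uv yz).
    - by case: noz; exists v.
    - by case: noz; exists u; apply: (eb_triangle fd uv yz).
    - by split=> //; apply: (eb_inj fd uv yz).
  constructor 2; exists (y, z); first by rewrite inE; apply/asboolP.
  exact: orb2 iso.
have cardI p : p \in I -> #|[set p.1; p.2]| = 2%N.
  by rewrite inE => /asboolP[_ /eqP nxy _]; rewrite cards2 nxy.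
have [|cP cV] := partition_card_size (fibre_partition (orbit_b_eq fd)).
  by move=> A /kind[[x _ ->]|[p /cardI + ->]|] => [|->|->] //; rewrite cards1.
have P1 : [set A in orbit_b eb @: V | #|A| == 1%N] = [set [set x] | x in loops_b eb].
  apply/finset.setP => A; rewrite inE; apply/andP/imsetP => [[/kind[[x xx ->]|[p /cardI + ->]|]]|[x]].
  - by exists x; rewrite ?inE.
  - by move=> ->.
  - by move=> ->.
  rewrite inE => xx ->; rewrite cards1; split=> //; apply/imsetP; exists x => //.
  by rewrite orb1.
have P2 : [set A in orbit_b eb @: V | #|A| == 2%N] = [set [set p.1; p.2] | p in I].
  apply/finset.setP => A; rewrite inE; apply/andP/imsetP => [[/kind[[x xx ->]|[p pI ->]|]]|[p pI ->]].
  - by rewrite cards1.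
  - by exists p.
  - by move=> ->.
  split; last by rewrite cardI.
  by apply/imsetP; exists p.1 => //; rewrite (@orb2 _ p.2) //; move: pI; rewrite inE => /asboolP.
(* Two isolated edges with the same ends are equal, because an isolated edge is the only b-edge
   touching its ends. *)
have I_inj : {in I &, injective (fun p : V * V => [set p.1; p.2])}.
  move=> [x y] [x' y']; rewrite !inE => -[_ nxy iso] [xy' _ _] /= e.
  have : x' \in [set x; y] by rewrite e !inE eqxx.
  rewrite !inE => x'xy; suff [-> ->] : x' = x /\ y' = y by [].
  by apply: iso xy' _; case/orP: x'xy => /eqP; [left|right; left].
exists #|[set A in orbit_b eb @: V | #|A| == 3%N]|.
move: cP cV; rewrite P1 P2 (card_imset _ (@finset.set1_inj V)) (card_in_imset I_inj).
have -> : #|[pred p : V * V | `[< isolated_bedge Gm p.1 p.2 >]]| = #|I| by rewrite /I cardsE.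
by move=> -> ->.
Qed.

End OrbitCounts.

(** * Counting *)

Section RootLoops.
Variables (V : Type) (v0 : V).

(** At most a loop at [v0] is added, and only where [v0] lies on no edge of [e]. Equality of [e] and
    [e'] is allowed, so that an added a-loop and an added b-loop are treated together. *)
Definition root_loop_extension (e e' : V -> V -> Prop) : Prop :=
  (forall x y, e x y -> e' x y) /\
  forall x y, e' x y -> e x y \/ [/\ x = v0, y = v0 & ~ on_edge e v0].

Lemma root_loop_extension_refl e : root_loop_extension e e.
Proof. by split=> // x y; left. Qed.

Lemma extension_on_edge e e' x : root_loop_extension e e' -> x <> v0 ->
  on_edge e' x <-> on_edge e x.
Proof.
move=> [ee' e'e] xv; split=> [[y []]|[y []]].
- by case/e'e => [|[]//]; exists y; left.
- by case/e'e => [|[]//]; exists y; right.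
- by move/ee'; exists y; left.
- by move/ee'; exists y; right.
Qed.

Variables (ea eb ea' eb' : V -> V -> Prop).
Hypothesis exta : root_loop_extension ea ea'.
Hypothesis extb : root_loop_extension eb eb'.

Lemma extension_reads w x y : reads ea eb w x y -> reads ea' eb' w x y.
Proof.
case: exta extb => [aa' _] [bb' _]; elim: w x => //= l w IH x [z xz /IH zy].
by exists z => //; case: l xz => /=; auto.
Qed.

Lemma reads_extension w x y : reads ea' eb' w x y -> exists w', reads ea eb w' x y.
Proof.
case: exta extb => [_ a'a] [_ b'b]; elim: w x => [|l w IH] x /=.
  by move=> ->; exists [::].
move=> [z xz /IH[w' zy]].
have : ledge ea eb l x z \/ x = z.
  by case: l xz => /= [/a'a|/b'b|/b'b] [|[-> ->] _]; auto.
by case=> [xz'|->]; [exists (l :: w'), z|exists w'].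
Qed.

(** A new loop shares no vertex with an old edge of its kind, so each condition concerns either old
    edges alone or the new loop alone. *)
Lemma extension_folded : folded ea eb <-> folded ea' eb'.
Proof.
case: exta extb => [aa' a'a] [bb' b'b]; split=> fd; split.
- move=> x y xy; case/a'a: (xy) => [/(ea_sym fd)/aa'//|[ex ey _]].
  by rewrite ex ey in xy *.
- move=> x y z /a'a[xy|[-> -> no]] /a'a[xz|[ex ez no']] //.
  + exact: (ea_fun fd xy xz).
  + by case: no'; exists y; left; rewrite -ex.
  + by case: no; exists z; left.
- move=> x y z /b'b[xy|[-> -> no]] /b'b[xz|[ex ez no']] //.
  + exact: (eb_fun fd xy xz).
  + by case: no'; exists y; left; rewrite -ex.
  + by case: no; exists z; left.
- move=> x y z /b'b[xz|[-> -> no]] /b'b[yz|[ey ez no']] //.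
  + exact: (eb_inj fd xz yz).
  + by case: no'; exists x; right; rewrite -ez.
  + by case: no; exists y; right.
- move=> x y z xy' yz'; case/b'b: (xy') (yz') => [xy|[ex ey no]] /b'b[yz|[ey' ez no']].
  + exact/bb'/(eb_triangle fd xy yz).
  + by case: no'; exists x; right; rewrite -ey'.
  + by case: no; exists z; left; rewrite -ey.
  + by rewrite ex ez; rewrite ex ey in xy'.
- move=> x y xy; case/a'a: (ea_sym fd (aa' _ _ xy)) => // -[ey ex no].
  by case: no; exists y; left; rewrite -ex.
- by move=> x y z /aa' xy /aa' xz; apply: (ea_fun fd xy xz).
- by move=> x y z /bb' xy /bb' xz; apply: (eb_fun fd xy xz).
- by move=> x y z /bb' xy /bb' xz; apply: (eb_inj fd xy xz).
- move=> x y z xy yz; case/b'b: (eb_triangle fd (bb' _ _ xy) (bb' _ _ yz)) => // -[ez ex no].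
  by case: no; exists y; left; rewrite -ex.
Qed.

Lemma extension_rooted_graph : rooted_graph ea eb v0 <-> rooted_graph ea' eb' v0.
Proof.
split=> -[fd rd ona onb]; split.
- exact/extension_folded.
- by move=> x; have [w /extension_reads] := rd x; exists w.
- by move=> x xv; apply/(extension_on_edge exta xv)/ona.
- by move=> x xv; apply/(extension_on_edge extb xv)/onb.
- exact/extension_folded.
- by move=> x; have [w /reads_extension] := rd x.
- by move=> x xv; apply/(extension_on_edge exta xv)/ona.
- by move=> x xv; apply/(extension_on_edge extb xv)/onb.
Qed.

End RootLoops.

Lemma card_fintype_set (T : finType) (P : T -> Prop) :
  ([set x | P x]%classic #= `I_#|[pred x | `[< P x >]]|)%card.
Proof.
pose A := [pred x | `[< P x >]]; pose f x := index x (enum A).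
have f_inj : {in [set x | P x]%classic &, injective f}.
  move=> x y /set_mem /= Px /set_mem /= Py.
  by apply: (index_inj x (s := enum A)); rewrite mem_enum inE.
apply: card_eq_trans (_ : ((f @` [set x | P x])%classic #= _)%card).
  by rewrite card_eq_sym; apply: inj_card_eq.
suff -> : (f @` [set x | P x] = `I_#|A|)%classic by [].
apply/seteqP; split=> [_ [x /= Px <-]|k /= kA].
  by rewrite /f cardE index_mem mem_enum inE.
rewrite cardE in kA; have [x0 _] : exists x0 : T, true by case: (enum A) kA => // x; exists x.
exists (nth x0 (enum A) k); last by rewrite /f index_uniq // enum_uniq.
by have := mem_nth x0 kA; rewrite mem_enum inE.
Qed.

Lemma card_dep_pairs (T U : finType) (S : pred T) (P : T -> pred U) c :
  (forall x, S x -> #|P x| = c) -> #|[pred p : T * U | S p.1 && P p.1 p.2]| = (c * #|S|)%N.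
Proof.
move=> cP.
transitivity (\sum_(x | S x) \sum_(y | P x y) 1)%N; first by rewrite pair_big_dep -sum1_card; apply: eq_bigl.
rewrite (eq_bigr (fun=> c)) => [|x /cP <-]; last by rewrite sum1_card.
by rewrite sum_nat_const mulnC.
Qed.

(** * Rooted labeled graphs and labeled subgroups *)

Section LabeledGraphs.
Variable n : nat.
Implicit Type p : labeled_graph n * 'I_n.

Definition edge_rel (E : {set 'I_n * 'I_n}) : rel 'I_n := fun x y => (x, y) \in E.

Definition rooted p : Prop := rooted_graph (edge_rel p.1.1) (edge_rel p.1.2) p.2.

(** The bijection behind the counts: on rooted graphs its values are the subgroups of size n with a
    labeling of their Stallings vertices. *)
Definition graph_subgroup p : set PSL2Z * ('I_n -> set PSL2Z) :=
  (loop_group (edge_rel p.1.1) (edge_rel p.1.2) p.2,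
   path_class (edge_rel p.1.1) (edge_rel p.1.2) p.2).

(** The isomorphism type as seen on the graph: the third equation is the rank formula from the
    spanning tree and determines [r]. *)
Definition graph_type (l2 l3 r : nat) p : Prop :=
  [/\ num_loops_a p.1 = l2, num_loops_b p.1 = l3 &
      (r + #|orbit_a (edge_rel p.1.1) @: 'I_n| + #|orbit_b (edge_rel p.1.2) @: 'I_n| = n.+1)%N].

Lemma num_loops_aE (g : labeled_graph n) : num_loops_a g = #|loops_a (edge_rel g.1)|.
Proof. by rewrite /loops_a cardsE. Qed.

Lemma num_loops_bE (g : labeled_graph n) : num_loops_b g = #|loops_b (edge_rel g.2)|.
Proof. by rewrite /loops_b cardsE. Qed.

Section RootedGraph.
Variable p : labeled_graph n * 'I_n.
Hypothesis rg : rooted p.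

Let L := (graph_subgroup p).1.
Let lam := (graph_subgroup p).2.
Let sgL : subgroup L := loop_group_subgroup _ (rooted_folded rg).

Lemma graph_subgroup_range : range lam = vertex (stallings L).
Proof.
apply/seteqP; split=> [_ [x _ <-]|c /(stallings_vertex rg)[x ->]]; last by exists x.
by apply/(stallings_vertex rg); exists x.
Qed.

Lemma graph_subgroup_size : (vertex (stallings L) #= `I_n)%card.
Proof.
rewrite -graph_subgroup_range.
apply: card_eq_trans (_ : ([set: 'I_n]%classic #= _)%card).
  by apply: inj_card_eq => x y _ _; apply: (path_class_graph_inj rg).
by rewrite card_eq_sym; apply: card_II.
Qed.

(** [loop_group_iso_type] provides one type of the loop group, and [has_iso_type_uniq] excludes any
    other. *)
Lemma graph_subgroup_type l2 l3 r : size_type_class n l2 l3 r L <-> graph_type l2 l3 r p.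
Proof.
have [r' [ty fg cr]] := loop_group_iso_type rg; rewrite card_ord in cr.
rewrite /graph_type num_loops_aE num_loops_bE; split=> [[_ _ _ ty']|[<- <- er]].
  by have [<- <- <-] := has_iso_type_uniq ty ty'.
have -> : r = r' by have := etrans er (esym cr); rewrite -!addnA => /addIn.
by split=> //; apply: graph_subgroup_size.
Qed.

Lemma graph_root_on_a : root_on_a_edge L <-> on_edge (edge_rel p.1.1) p.2.
Proof.
rewrite /root_on_a_edge (path_class_root rg); split=> [[c ec]|[y ey]].
  have [_ /(stallings_vertex rg)[y cy]] := stallings_sedge_vertex sgL (l := La) ec.
  by exists y; left; apply/(stallings_aedge rg); rewrite -cy.
exists (lam y); apply/(stallings_aedge rg).
by case: ey => // /(ea_sym (rooted_folded rg)).
Qed.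

Lemma graph_root_on_b : root_on_b_edge L <-> on_edge (edge_rel p.1.2) p.2.
Proof.
rewrite /root_on_b_edge (path_class_root rg); split=> [[c ec]|[y ey]].
  have : vertex (stallings L) c.
    by case: ec => /(stallings_sedge_vertex sgL (l := Lb))[].
  move=> /(stallings_vertex rg)[y cy]; rewrite cy in ec.
  by exists y; case: ec => /(stallings_bedge rg); [left|right].
by exists (lam y); case: ey => ey; [left|right]; apply/(stallings_bedge rg).
Qed.

Lemma graph_cyclically_reduced : cyclically_reduced_subgroup L <->
  on_edge (edge_rel p.1.1) p.2 /\ on_edge (edge_rel p.1.2) p.2.
Proof.
have root_vtx : vertex (stallings L) (root_vertex L).
  by rewrite -graph_subgroup_range (path_class_root rg); exists p.2.
rewrite -graph_root_on_a -graph_root_on_b; split=> [cr|[ona onb]].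
  have [ona onb] := cyclically_reduced_on_edge cr root_vtx.
  split=> //; case: ona => c [|/(ea_sym (cyclically_reduced_folded cr))]; by exists c.
have ledge_vtx := stallings_sedge_vertex sgL.
apply: (folded_cyclically_reduced (x0 := root_vertex L)) => //.
- exact: stallings_folded.
- exact: (ledge_vtx La).
- exact: (ledge_vtx Lb).
- by exists n; apply: graph_subgroup_size.
- by move=> x [u [v [g Luv ->]]]; exists u; apply: stallings_prefix g Luv.
move=> x vx; have [->|xr] := pselect (x = root_vertex L).
  by split=> //; case: ona => c ec; exists c; left.
exact: stallings_on_edge vx xr.
Qed.

End RootedGraph.

(** The root is the vertex labeled by the root coset, and the edges are those of the Stallings graph
    seen through the labels. *)
Lemma graph_subgroup_inj p q :
  rooted p -> rooted q -> graph_subgroup p = graph_subgroup q -> p = q.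
Proof.
case: p q => -[A B] x [[A' B'] y] /= rp rq [eL elam].
have e_root : x = y.
  apply: (path_class_graph_inj rp); rewrite -(path_class_root rp) eL (path_class_root rq).
  by rewrite elam.
have eA : A = A'.
  apply/finset.setP => -[i j]; apply/idP/idP.
    by move=> /(stallings_aedge rp); rewrite eL elam => /(stallings_aedge rq).
  by move=> /(stallings_aedge rq); rewrite -eL -elam => /(stallings_aedge rp).
have eB : B = B'.
  apply/finset.setP => -[i j]; apply/idP/idP.
    by move=> /(stallings_bedge rp); rewrite eL elam => /(stallings_bedge rq).
  by move=> /(stallings_bedge rq); rewrite -eL -elam => /(stallings_bedge rp).
by rewrite e_root eA eB.
Qed.

Lemma graph_subgroup_surj H (lab : 'I_n -> set PSL2Z) : subgroup H -> injective lab ->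
  range lab = vertex (stallings H) -> exists2 p, rooted p & graph_subgroup p = (H, lab).
Proof.
move=> sgH lab_inj lab_range; have [v0 lab_v0] := label_root sgH lab_range.
pose g : labeled_graph n := ([set p | label_a H lab p.1 p.2], [set p | label_b H lab p.1 p.2]).
have ea : edge_rel g.1 = label_a H lab.
  by apply/funext => x; apply/funext => y; rewrite /edge_rel inE.
have eb : edge_rel g.2 = label_b H lab.
  by apply/funext => x; apply/funext => y; rewrite /edge_rel inE.
exists (g, v0); first by rewrite /rooted ea eb; apply: label_rooted_graph.
by rewrite /graph_subgroup ea eb label_loop_group // label_path_class.
Qed.

Lemma labeled_subgroups_card l2 l3 r (Q : set PSL2Z -> Prop)
    (q : labeled_graph n * 'I_n -> Prop) :
  (forall p, rooted p -> Q (graph_subgroup p).1 <-> q p) ->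
  (labeled_subgroups n [set H | size_type_class n l2 l3 r H /\ Q H]%classic #=
   `I_#|[pred p | `[< [/\ rooted p, graph_type l2 l3 r p & q p] >]]|)%card.
Proof.
move=> Qq; pose D : set (labeled_graph n * 'I_n) :=
  [set p | [/\ rooted p, graph_type l2 l3 r p & q p]]%classic.
have -> : labeled_subgroups n [set H | size_type_class n l2 l3 r H /\ Q H]%classic =
    (graph_subgroup @` D)%classic.
  apply/seteqP; split=> [[H lab] [/= [st QH] lab_inj lab_range]|_ [p [rp tp qp] <-]].
    have [|p rp ep] := graph_subgroup_surj _ lab_inj lab_range; first by case: st.
    exists p => //; have eH : (graph_subgroup p).1 = H by rewrite ep.
    by split=> //; [apply/(graph_subgroup_type rp)|apply/(Qq _ rp)]; rewrite eH.
  split; last exact: graph_subgroup_range.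
    by split; [apply/graph_subgroup_type|apply/Qq].
  exact: path_class_graph_inj.
apply: card_eq_trans (card_fintype_set _); apply: inj_card_eq.
by move=> p p' /set_mem [rp _ _] /set_mem [rp' _ _]; apply: graph_subgroup_inj.
Qed.

(** Every vertex of a cyclically reduced graph can serve as root, which is the source of the factor
    n. *)
Lemma cyclically_reduced_rooted (p : labeled_graph n * 'I_n) :
  cyclically_reduced (abgraph_of p.1) <->
  [/\ rooted p, on_edge (edge_rel p.1.1) p.2 & on_edge (edge_rel p.1.2) p.2].
Proof.
split=> [cr|[rp ona onb]].
  have on x := cyclically_reduced_on_edge cr (x := x) I.
  have fd := cyclically_reduced_folded cr.
  split; [|exact: (on _).1|exact: (on _).2].
  split=> // [x|x _|x _]; [|exact: (on _).1|exact: (on _).2].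
  by case: cr => _ _ [_ conn] _ _; apply: clos_reads (conn _ _ _ _).
apply: (folded_cyclically_reduced (x0 := p.2)) => //.
- exact: rooted_folded rp.
- by move=> x _; apply: rooted_reads rp x.
move=> x _; have [->|xv] := pselect (x = p.2) => //.
by split; [apply: rooted_on_a rp _ xv|apply: rooted_on_b rp _ xv].
Qed.

Lemma cyclically_reduced_count (g : labeled_graph n) : cyclically_reduced (abgraph_of g) ->
  [/\ n = (num_loops_a g + 2 * num_isolated_a g)%N,
      #|orbit_a (edge_rel g.1) @: 'I_n| = (num_loops_a g + num_isolated_a g)%N &
      exists t, n = (num_loops_b g + 2 * num_isolated_b g + 3 * t)%N /\
        #|orbit_b (edge_rel g.2) @: 'I_n| = (num_loops_b g + num_isolated_b g + t)%N].
Proof.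
move=> cr; have on x := cyclically_reduced_on_edge cr (x := x) I.
have fd : folded (edge_rel g.1) (edge_rel g.2) := cyclically_reduced_folded cr.
have [nA cA] := orbit_a_count fd (fun x => (on x).1).
have [t [nB cB]] := orbit_b_count (Gm := abgraph_of g) fd (fun x => (on x).2) (fun x y => iff_refl _).
rewrite num_loops_aE num_loops_bE; rewrite card_ord in nA nB.
have eE : [set p : 'I_n * 'I_n | edge_rel g.1 p.1 p.2] = g.1.
  by apply/finset.setP => -[x y]; rewrite inE.
by rewrite eE in nA cA; split=> //; exists t.
Qed.

(** By determinism in both directions, a vertex with a loop lies on no other edge of that kind. *)
Lemma root_loop_extension_del (E : {set 'I_n * 'I_n}) (v : 'I_n) :
  (v, v) \in E -> (forall x y z, edge_rel E x y -> edge_rel E x z -> y = z) ->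
  (forall x y z, edge_rel E x z -> edge_rel E y z -> x = y) ->
  root_loop_extension v (edge_rel (E :\ (v, v))) (edge_rel E).
Proof.
move=> vE e_fun e_inj; split=> x y; rewrite /edge_rel !inE; first by case/andP.
have [[-> ->] _|_ xy] := eqVneq (x, y) (v, v); last by left.
right; split=> // -[z]; rewrite /edge_rel !inE => -[] /andP[nz zE].
  by rewrite (e_fun _ _ _ zE vE) eqxx in nz.
by rewrite (e_inj _ _ _ zE vE) eqxx in nz.
Qed.

Lemma edge_relD1_del (E : {set 'I_n * 'I_n}) v x y : x != y ->
  edge_rel (E :\ (v, v)) x y = edge_rel E x y.
Proof.
move=> nxy; rewrite /edge_rel !inE; case: eqP => //= -[ex ey].
by rewrite ex ey eqxx in nxy.
Qed.

(** A vertex belongs to its own orbit with or without a loop; hence deleting a loop preserves the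
    orbits and therefore [r]. *)
Lemma orbit_a_del (E : {set 'I_n * 'I_n}) v :
  orbit_a (edge_rel (E :\ (v, v))) =1 orbit_a (edge_rel E).
Proof.
move=> x; apply/finset.setP => y; rewrite !inE; case: (eqVneq y x) => //= nyx.
by rewrite edge_relD1_del // eq_sym.
Qed.

Lemma orbit_b_del (E : {set 'I_n * 'I_n}) v :
  orbit_b (edge_rel (E :\ (v, v))) =1 orbit_b (edge_rel E).
Proof.
move=> x; apply/finset.setP => y; rewrite !inE; case: (eqVneq y x) => //= nyx.
by rewrite !edge_relD1_del // eq_sym.
Qed.

Lemma card_loops_del (E : {set 'I_n * 'I_n}) (v : 'I_n) : (v, v) \in E ->
  #|[pred x : 'I_n | (x, x) \in E]| = #|[pred x : 'I_n | (x, x) \in E :\ (v, v)]|.+1.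
Proof.
move=> vE; rewrite (cardD1 v) inE vE add1n; congr _.+1.
apply: eq_card => x; rewrite !inE; congr (~~ _ && _).
by apply/eqP/eqP => [->|[]].
Qed.

Definition del_root_a p : labeled_graph n * 'I_n := ((p.1.1 :\ (p.2, p.2), p.1.2), p.2).
Definition del_root_b p : labeled_graph n * 'I_n := ((p.1.1, p.1.2 :\ (p.2, p.2)), p.2).

Lemma graph_type_del_a l2 l3 r p : (p.2, p.2) \in p.1.1 ->
  graph_type l2 l3 r (del_root_a p) <-> graph_type l2.+1 l3 r p.
Proof.
move=> loop; rewrite /graph_type /num_loops_a (card_loops_del loop) /=.
rewrite (eq_imset _ (orbit_a_del _ _)).
by split=> -[e2 e3 er]; split=> //; [rewrite e2|apply: succn_inj].
Qed.

Lemma graph_type_del_b l2 l3 r p : (p.2, p.2) \in p.1.2 ->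
  graph_type l2 l3 r (del_root_b p) <-> graph_type l2 l3.+1 r p.
Proof.
move=> loop; rewrite /graph_type /num_loops_b (card_loops_del loop) /=.
rewrite (eq_imset _ (orbit_b_del _ _)).
by split=> -[e2 e3 er]; split=> //; [rewrite e3|apply: succn_inj].
Qed.

(** Deleting the root loop is a bijection from the cyclically reduced graphs rooted at an a-loop;
    restoring the loop is its inverse. The number of a-loops drops by one while [r] is kept. *)
Lemma del_root_a_card l2 l3 r :
  #|[pred p | `[< [/\ rooted p, graph_type l2 l3 r p &
      ~ on_edge (edge_rel p.1.1) p.2 /\ on_edge (edge_rel p.1.2) p.2] >]]| =
  #|[pred p : labeled_graph n * 'I_n | `[< cyclically_reduced (abgraph_of p.1) /\
      graph_type l2.+1 l3 r p >] && ((p.2, p.2) \in p.1.1)]|.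
Proof.
rewrite -[RHS](card_in_image (f := del_root_a)).
  apply: eq_card => p; rewrite inE; apply/asboolP/fintype.imageP => [[rp ty [noa onb]]|].
    pose q : labeled_graph n * 'I_n := (((p.2, p.2) |: p.1.1, p.1.2), p.2).
    have np : (p.2, p.2) \notin p.1.1 by apply/negP => pp; apply: noa; exists p.2; left.
    have eq_p : p = del_root_a q.
      by rewrite /del_root_a /= setU1K //; case: (p) => -[].
    have qq : (q.2, q.2) \in q.1.1 by rewrite !inE eqxx.
    exists q => //; rewrite inE qq andbT; apply/asboolP; split; last first.
      by apply/graph_type_del_a => //; rewrite -eq_p.
    apply/cyclically_reduced_rooted; split=> //; last by exists p.2; left.
    apply/(extension_rooted_graph (ea := edge_rel p.1.1) (eb := edge_rel p.1.2)) => //.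
      split=> x y; rewrite /edge_rel !inE; first by move->; rewrite orbT.
      by case/orP => [/eqP[-> ->]|]; [right|left].
    exact: root_loop_extension_refl.
  move=> [q]; rewrite inE => /andP[/asboolP[cr ty] loop] ->.
  have [rq _ onb] := (cyclically_reduced_rooted q).1 cr.
  have fd := rooted_folded rq.
  have ext : root_loop_extension q.2 (edge_rel (q.1.1 :\ (q.2, q.2))) (edge_rel q.1.1).
    apply: root_loop_extension_del loop (ea_fun fd) _ => x y z xz yz.
    exact: (ea_fun fd (ea_sym fd xz) (ea_sym fd yz)).
  split; [|exact/graph_type_del_a|split=> //].
    by apply/(extension_rooted_graph ext (root_loop_extension_refl _ _)).
  have [_ /(_ q.2 q.2 loop)[|[]//]] := ext.
  by rewrite /edge_rel !inE eqxx.
move=> [[A B] x] [[A' B'] x']; rewrite !inE /= => /andP[_ xA] /andP[_ xA'].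
rewrite /del_root_a /= => -[eA eB ex].
by rewrite -(finset.setD1K xA) -(finset.setD1K xA') eA eB ex.
Qed.

Lemma del_root_b_card l2 l3 r :
  #|[pred p | `[< [/\ rooted p, graph_type l2 l3 r p &
      on_edge (edge_rel p.1.1) p.2 /\ ~ on_edge (edge_rel p.1.2) p.2] >]]| =
  #|[pred p : labeled_graph n * 'I_n | `[< cyclically_reduced (abgraph_of p.1) /\
      graph_type l2 l3.+1 r p >] && ((p.2, p.2) \in p.1.2)]|.
Proof.
rewrite -[RHS](card_in_image (f := del_root_b)).
  apply: eq_card => p; rewrite inE; apply/asboolP/fintype.imageP => [[rp ty [ona nob]]|].
    pose q : labeled_graph n * 'I_n := ((p.1.1, (p.2, p.2) |: p.1.2), p.2).
    have np : (p.2, p.2) \notin p.1.2 by apply/negP => pp; apply: nob; exists p.2; left.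
    have eq_p : p = del_root_b q.
      by rewrite /del_root_b /= setU1K //; case: (p) => -[].
    have qq : (q.2, q.2) \in q.1.2 by rewrite !inE eqxx.
    exists q => //; rewrite inE qq andbT; apply/asboolP; split; last first.
      by apply/graph_type_del_b => //; rewrite -eq_p.
    apply/cyclically_reduced_rooted; split=> //; last by exists p.2; left.
    apply/(extension_rooted_graph (ea := edge_rel p.1.1) (eb := edge_rel p.1.2)) => //.
      exact: root_loop_extension_refl.
    split=> x y; rewrite /edge_rel !inE; first by move->; rewrite orbT.
    by case/orP => [/eqP[-> ->]|]; [right|left].
  move=> [q]; rewrite inE => /andP[/asboolP[cr ty] loop] ->.
  have [rq ona _] := (cyclically_reduced_rooted q).1 cr.
  have fd := rooted_folded rq.
  have ext : root_loop_extension q.2 (edge_rel (q.1.2 :\ (q.2, q.2))) (edge_rel q.1.2).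
    exact: root_loop_extension_del loop (eb_fun fd) (eb_inj fd).
  split; [|exact/graph_type_del_b|split=> //].
    by apply/(extension_rooted_graph (root_loop_extension_refl _ _) ext).
  have [_ /(_ q.2 q.2 loop)[|[]//]] := ext.
  by rewrite /edge_rel !inE eqxx.
move=> [[A B] x] [[A' B'] x']; rewrite !inE /= => /andP[_ xA] /andP[_ xA'].
rewrite /del_root_b /= => -[eA eB ex].
by rewrite -(finset.setD1K xA) -(finset.setD1K xA') eA eB ex.
Qed.

End LabeledGraphs.

(* The three counts *)
Local Close Scope group_scope.
Local Open Scope ring_scope.

(** [P g] is the set of admissible roots of [g]: all vertices in the first count, the vertices with
    a b-loop or with an a-loop in the others. *)
Lemma s_number_pairs n k2 k3 l2 l3 l2' l3' r c
    (P : labeled_graph n -> pred 'I_n) :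
  (forall p : labeled_graph n * 'I_n, cyclically_reduced (abgraph_of p.1) ->
    (graph_type l2' l3' r p <-> [/\ Posz (num_isolated_a p.1) = k2,
       Posz (num_isolated_b p.1) = k3, num_loops_a p.1 = l2 & num_loops_b p.1 = l3])) ->
  (forall g : labeled_graph n, num_loops_a g = l2 -> num_loops_b g = l3 -> #|P g| = c) ->
  #|[pred p : labeled_graph n * 'I_n |
     `[< cyclically_reduced (abgraph_of p.1) /\ graph_type l2' l3' r p >] && P p.1 p.2]| =
  (c * s_number n k2 k3 l2 l3)%N.
Proof.
move=> ty cP; rewrite -(@card_dep_pairs _ _ _ P); last first.
  by move=> g /and5P[_ _ _ /eqP ? /eqP ?]; apply: cP.
apply: eq_card => p; rewrite !inE; congr (_ && _).
apply/asboolP/and5P => [[cr /(ty _ cr)[-> -> -> ->]]|[/asboolP cr /eqP ? /eqP ? /eqP ? /eqP ?]].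
  by split=> //; apply/asboolP.
by split=> //; apply/ty.
Qed.

Theorem proposition4p3 (l2 l3 r n : nat) (n_gt0 : (0 < n)%N) :
  let k2 := int_half (n%:Z - l2%:Z) in
  let k3 := int_half (n%:Z - 3 * l2%:Z - 4 * l3%:Z - 6 * r%:Z + 6) in
  let k3' := int_half (n%:Z - 3 * l2%:Z - 4 * l3%:Z - 6 * r%:Z + 2) in
  let k3'' := int_half (n%:Z - 3 * l2%:Z - 4 * l3%:Z - 6 * r%:Z + 4) in
  [/\ (labeled_subgroups n [set H | size_type_class n l2 l3 r H
                                    /\ cyclically_reduced_subgroup H]%classic
         #= `I_(n * s_number n k2 k3 l2 l3)%N)%card,
      (labeled_subgroups n [set H | size_type_class n l2 l3 r H
                                    /\ ~ cyclically_reduced_subgroup H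
                                    /\ root_on_a_edge H]%classic
         #= `I_((l3 + 1) * s_number n k2 k3' l2 (l3 + 1))%N)%card &
      (labeled_subgroups n [set H | size_type_class n l2 l3 r H
                                    /\ ~ cyclically_reduced_subgroup H
                                    /\ root_on_b_edge H]%classic
         #= `I_((l2 + 1) * s_number n k2 k3'' (l2 + 1) l3)%N)%card].
Proof.
move=> k2 k3 k3' k3''; split.
- rewrite -(@s_number_pairs n k2 k3 l2 l3 l2 l3 r n (fun _ => predT)).
  + apply: card_eq_trans (labeled_subgroups_card (q := fun p =>
      on_edge (edge_rel p.1.1) p.2 /\ on_edge (edge_rel p.1.2) p.2) l2 l3 r _) _.
      by move=> p; apply: graph_cyclically_reduced.
    rewrite (eq_card (B := [pred p | `[< cyclically_reduced (abgraph_of p.1) /\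
      graph_type l2 l3 r p >] && predT p.2])) //.
    move=> p; rewrite !inE andbT; apply/asboolP/asboolP.
      by move=> [rp ty [ona onb]]; split=> //; apply/cyclically_reduced_rooted.
    by move=> [/cyclically_reduced_rooted[rp ona onb] ty].
  + move=> p /cyclically_reduced_count[nA cA [t [nB cB]]].
    rewrite /graph_type cA cB /k2 /k3 /int_half.
    (* From n = l2 + 2 k2 = l3 + 2 k3 + 3 t and r + (l2 + k2) + (l3 + k3 + t) = n + 1, eliminating t
       and k2 gives 2 k3 = n - 3 l2 - 4 l3 - 6 r + 6. *)
    by split=> [[ea eb er]|[e2 e3 ea eb]]; split; lia.
  + by move=> g _ _; rewrite card_ord.
- rewrite !addn1 -(@s_number_pairs n k2 k3' l2 l3.+1 l2 l3.+1 r l3.+1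
    (fun g => [pred x | (x, x) \in g.2])).
  + rewrite -del_root_b_card; apply: labeled_subgroups_card => p rp.
    by rewrite (graph_cyclically_reduced rp) (graph_root_on_a rp); tauto.
  + move=> p /cyclically_reduced_count[nA cA [t [nB cB]]].
    rewrite /graph_type cA cB /k2 /k3' /int_half.
    (* The extra b-loop lowers the constant 6 by 4. *)
    by split=> [[ea eb er]|[e2 e3 ea eb]]; split; lia.
  + by move=> g _ <-.
- rewrite !addn1 -(@s_number_pairs n k2 k3'' l2.+1 l3 l2.+1 l3 r l2.+1
    (fun g => [pred x | (x, x) \in g.1])).
  + rewrite -del_root_a_card; apply: labeled_subgroups_card => p rp.
    by rewrite (graph_cyclically_reduced rp) (graph_root_on_b rp); tauto.
  + move=> p /cyclically_reduced_count[nA cA [t [nB cB]]].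
    rewrite /graph_type cA cB /k2 /k3'' /int_half.
    (* The extra a-loop lowers the constant 6 by 3. As n - l2 is now odd, [int_half] rounds down, so
       the constants 4 in [k3''] and 0 in [k2] act as 3 and -1. *)
    by split=> [[ea eb er]|[e2 e3 ea eb]]; split; lia.
  + by move=> g <- _.
Qed.
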